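(* Let $\Omega\subset\mathbb{R}^2$ be an open and bounded Lipschitz domain. Let $g$ and $k$ be scalar functions that are uniformly positive and continuous throughout the closure $\overline{\Omega}$. Let $\mathcal{A},\mathcal{B}:H_0^1(\Omega)\to H^{-1}(\Omega)$ be defined by $$\langle\mathcal{A}u,v\rangle=\int_\Omega k(x)\,\nabla u\cdot\nabla v,\qquad \langle\mathcal{B}u,v\rangle=\int_\Omega g(x)\,\nabla u\cdot\nabla v,\qquad u,v\in H_0^1(\Omega).$$ Then the spectrum of the operator $\mathcal{B}^{-1}\mathcal{A}:H_0^1(\Omega)\to H_0^1(\Omega)$ equals the interval $$\mathrm{sp}(\mathcal{B}^{-1}\mathcal{A})=\left[\inf_{x\in\overline{\Omega}}\frac{k(x)}{g(x)},\ \sup_{x\in\overline{\Omega}}\frac{k(x)}{g(x)}\right].$$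
   Context: A domain is a connected open set. $H^{-1}(\Omega)$ is the dual of the real Hilbert space $H_0^1(\Omega)$ and $\langle\cdot,\cdot\rangle$ is the duality pairing. A function is uniformly positive if it is bounded below by a positive constant. The spectrum is the complement of the resolvent set: $$\mathrm{sp}(\mathcal{B}^{-1}\mathcal{A})=\{\lambda\in\mathbb{C};\ \lambda\mathcal{I}-\mathcal{B}^{-1}\mathcal{A}\text{ does not have a bounded inverse}\},$$ where, for non-real $\lambda$, the operator is understood, as usual, as extended to the complexification of the space. *)

(* Defs.v *)
From HB Require Import structures.
From mathcomp Require Import all_boot all_order all_algebra complex.
From mathcomp Require Import all_classical all_reals all_analysis.
From mathcomp Require Import measurable_realfun.
From mathcomp Require Import ring lra.
Set Implicit Arguments.
Unset Strict Implicit.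
Unset Printing Implicit Defensive.
Import Order.TTheory GRing.Theory Num.Theory.
Import numFieldNormedType.Exports.
Local Open Scope classical_set_scope.
Local Open Scope ring_scope.

(* [R * R] with the measurable structure on which [lebesgue_measure] lives;
   the bare type [R * R] gets a measurable structure with the same sets but
   with another display. *)
Notation mplane R := (measurableTypeR R * measurableTypeR R)%type.
Notation lebesgue2 := (lebesgue_measure \x lebesgue_measure)%E.

(* Hausdorff quotient of a real vector space carrying a symmetric positive
   semidefinite bilinear form, normed by the induced norm. *)
Record semi_inner (R : realType) (V : lmodType R) := SemiInner {
  sip :> V -> V -> R ;
  sipC : forall x y, sip x y = sip y x ;
  sipDl : forall x y z, sip (x + y) z = sip x z + sip y z ;
  sipZl : forall a x y, sip (a *: x) y = a * sip x y ;
  sip_ge0 : forall x, 0 <= sip x x }.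

Section quotient.
Context (R : realType) (V : lmodType R) (B : semi_inner V).
Local Open Scope quotient_scope.

Definition sipnorm (x : V) : R := Num.sqrt (B x x).

Let sipDr x y z : B z (x + y) = B z x + B z y.
Proof. by rewrite sipC sipDl !(sipC _ z). Qed.

Let sipZr a x y : B x (a *: y) = a * B x y.
Proof. by rewrite sipC sipZl sipC. Qed.

Lemma sip_cauchy_schwarz x y : B x y ^+ 2 <= B x x * B y y.
Proof.
have key (t : R) : 0 <= B x x + 2 * t * B x y + t ^+ 2 * B y y.
  have := sip_ge0 B (x + t *: y).
  rewrite sipDl !sipDr !sipZl !sipZr (sipC B y x).
  by congr (0 <= _); ring.
have [yy0|yy0] := eqVneq (B y y) 0.
  rewrite yy0 mulr0; have [->|xy0] := eqVneq (B x y) 0; first by rewrite expr0n.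
  have := key (- (B x x + 1) / (2 * B x y)).
  rewrite yy0 mulr0 addr0.
  have -> : 2 * (- (B x x + 1) / (2 * B x y)) * B x y = - (B x x + 1).
    by field.
  by rewrite opprD addrA subrr add0r oppr_ge0 ler10.
have yy_gt0 : 0 < B y y by rewrite lt0r yy0 sip_ge0.
have := key (- (B x y / B y y)).
have -> : B x x + 2 * - (B x y / B y y) * B x y + (- (B x y / B y y)) ^+ 2 * B y y
   = (B x x * B y y - B x y ^+ 2) / B y y.
  by field.
by rewrite pmulr_lge0 ?invr_gt0// subr_ge0.
Qed.

Lemma sipnormD x y : sipnorm (x + y) <= sipnorm x + sipnorm y.
Proof.
rewrite -(@ler_pXn2r _ 2)// ?nnegrE ?addr_ge0 ?sqrtr_ge0//.
rewrite sqrrD !sqr_sqrtr ?sip_ge0// sipDl !sipDr (sipC B y x).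
rewrite -!addrA lerD2l !addrA lerD2r -mulr2n lerMn2r /=.
rewrite -sqrtrM ?sip_ge0// (le_trans (ler_norm _))// -sqrtr_sqr.
by rewrite ler_sqrt// ?sip_cauchy_schwarz// mulr_ge0 ?sip_ge0.
Qed.

Lemma sipnormZ a x : sipnorm (a *: x) = `|a| * sipnorm x.
Proof.
by rewrite /sipnorm sipZl sipZr mulrA -expr2 sqrtrM ?sqr_ge0// sqrtr_sqr.
Qed.

Let sipnorm0 : sipnorm 0 = 0.
Proof. by rewrite -(scale0r 0) sipnormZ normr0 mul0r. Qed.

Let sipnormN x : sipnorm (- x) = sipnorm x.
Proof. by rewrite -scaleN1r sipnormZ normrN1 mul1r. Qed.

Let sipnorm_ge0 x : 0 <= sipnorm x.
Proof. exact: sqrtr_ge0. Qed.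

Definition sip_eq (x y : V) := sipnorm (x - y) == 0.

Let sip_eq_refl : reflexive sip_eq.
Proof. by move=> x; rewrite /sip_eq subrr sipnorm0. Qed.

Let sip_eq_sym : symmetric sip_eq.
Proof. by move=> x y; rewrite /sip_eq -sipnormN opprB. Qed.

Let sip_eq_trans : transitive sip_eq.
Proof.
move=> y x z /eqP xy /eqP yz; rewrite /sip_eq eq_le sipnorm_ge0 andbT.
by rewrite -(subrK y x) -addrA (le_trans (sipnormD _ _))// xy yz addr0.
Qed.

Canonical sip_eq_equiv := EquivRel sip_eq sip_eq_refl sip_eq_sym sip_eq_trans.

Definition sip_quot : Type := {eq_quot sip_eq}.
HB.instance Definition _ := Choice.on sip_quot.
HB.instance Definition _ := EqQuotient.on sip_quot.

Lemma sip_quotP (x y : V) :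
  reflect (sipnorm (x - y) = 0) (\pi_sip_quot x == \pi_sip_quot y).
Proof. by rewrite eqmodE; exact: eqP. Qed.

Lemma sip_quot_repr (x : V) : sipnorm (repr (\pi_sip_quot x) - x) = 0.
Proof. by apply/sip_quotP; rewrite reprK. Qed.

Definition sip_add (x y : sip_quot) : sip_quot := \pi_sip_quot (repr x + repr y).
Definition sip_opp (x : sip_quot) : sip_quot := \pi_sip_quot (- repr x).
Definition sip_scale (a : R) (x : sip_quot) : sip_quot := \pi_sip_quot (a *: repr x).
Definition sip_nrm (x : sip_quot) : R := sipnorm (repr x).

Lemma sip_quotW (P : sip_quot -> Prop) :
  (forall x : V, P (\pi_sip_quot x)) -> forall x, P x.
Proof. by move=> Pp x; rewrite -[x]reprK. Qed.

Lemma sip_piD x y : \pi_sip_quot (x + y) = sip_add (\pi_sip_quot x) (\pi_sip_quot y).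
Proof.
apply/esym/eqP/sip_quotP/eqP; rewrite eq_le sipnorm_ge0 andbT opprD addrACA.
by rewrite (le_trans (sipnormD _ _))// !sip_quot_repr addr0.
Qed.

Lemma sip_piN x : \pi_sip_quot (- x) = sip_opp (\pi_sip_quot x).
Proof.
apply/esym/eqP/sip_quotP.
by rewrite -opprD sipnormN sip_quot_repr.
Qed.

Lemma sip_piZ a x : \pi_sip_quot (a *: x) = sip_scale a (\pi_sip_quot x).
Proof.
by apply/esym/eqP/sip_quotP; rewrite -scalerBr sipnormZ sip_quot_repr mulr0.
Qed.

Lemma sip_pi_nrm x : sip_nrm (\pi_sip_quot x) = sipnorm x.
Proof.
apply/eqP; rewrite eq_le /sip_nrm; apply/andP; split.
  rewrite -[X in sipnorm X <= _](subrK x) (le_trans (sipnormD _ _))//.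
  by rewrite sip_quot_repr add0r.
rewrite -[X in sipnorm X <= _](subrK (repr (\pi_sip_quot x))).
by rewrite (le_trans (sipnormD _ _))// -sipnormN opprB sip_quot_repr add0r.
Qed.

Let addA : associative sip_add.
Proof.
by move=> x; elim/sip_quotW: x => x; move=> y; elim/sip_quotW: y => y; move=> z; elim/sip_quotW: z => z; rewrite -!sip_piD addrA.
Qed.

Let addC : commutative sip_add.
Proof. by move=> x y; rewrite /sip_add addrC. Qed.

Let add0 : left_id (\pi_sip_quot 0) sip_add.
Proof. by move=> x; elim/sip_quotW: x => x; rewrite -sip_piD add0r. Qed.

Let addN : left_inverse (\pi_sip_quot 0) sip_opp sip_add.
Proof. by move=> x; elim/sip_quotW: x => x; rewrite -sip_piN -sip_piD addNr. Qed.

HB.instance Definition _ := GRing.isZmodule.Build sip_quot addA addC add0 addN.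

Let scaleA a b v : sip_scale a (sip_scale b v) = sip_scale (a * b) v.
Proof. by elim/sip_quotW: v => x; rewrite -!sip_piZ scalerA. Qed.

Let scale1 : left_id 1 sip_scale.
Proof. by move=> x; elim/sip_quotW: x => x; rewrite -!sip_piZ scale1r. Qed.

Let scaleDr : right_distributive sip_scale sip_add.
Proof.
move=> a; move=> x; elim/sip_quotW: x => x; move=> y; elim/sip_quotW: y => y.
by rewrite -sip_piD -!sip_piZ -sip_piD scalerDr.
Qed.

Let scaleDl v : {morph sip_scale^~ v : a b / a + b >-> sip_add a b}.
Proof. by elim/sip_quotW: v => x a b /=; rewrite -!sip_piZ -sip_piD scalerDl. Qed.

HB.instance Definition _ := GRing.Zmodule_isLmodule.Build R sip_quot
  scaleA scale1 scaleDr scaleDl.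

Let nrmD (x y : sip_quot) : sip_nrm (sip_add x y) <= sip_nrm x + sip_nrm y.
Proof.
elim/sip_quotW: x => x; elim/sip_quotW: y => y.
by rewrite -sip_piD !sip_pi_nrm sipnormD.
Qed.

Let nrmZ (a : R) (x : sip_quot) : sip_nrm (sip_scale a x) = `|a| * sip_nrm x.
Proof. by elim/sip_quotW: x => x; rewrite -sip_piZ !sip_pi_nrm sipnormZ. Qed.

Let nrm0_eq0 (x : sip_quot) : sip_nrm x = 0 -> x = 0.
Proof.
elim/sip_quotW: x => x; rewrite sip_pi_nrm => x0.
by apply/eqP/sip_quotP; rewrite subr0.
Qed.

HB.instance Definition _ := Lmodule_isNormed.Build R sip_quot nrmD nrmZ nrm0_eq0.

End quotient.

Section plane_measurability.
Context (R : realType).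
Implicit Types (A : set (R * R)) (f : R * R -> R).

Lemma open_measurable2 A : open A -> measurable (A : set (mplane R)).
Proof.
move=> oA.
pose box (q : rat * rat * (rat * rat)) : set (R * R) :=
  `]ratr q.1.1, ratr q.1.2[%classic `*` `]ratr q.2.1, ratr q.2.2[%classic.
have -> : A = \bigcup_(q in [set q | box q `<=` A]) box q.
  apply/seteqP; split=> [[x y] Axy|z [q /= qA zq]]; last exact: qA.
  have /nbhs_ballP[e /= e0 eA] : nbhs (x, y) A by exact: open_nbhs_nbhs.
  have [] : x - e < x /\ x < x + e /\ y - e < y /\ y < y + e by split; lra.
  move=> /rat_in_itvoo[a] + [/rat_in_itvoo[b] + [/rat_in_itvoo[c] + /rat_in_itvoo[d]]].
  rewrite !in_itv/= => /andP[ea ax] /andP[xb be] /andP[ec cy] /andP[yd de].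
  exists ((a, b), (c, d)); last by split; rewrite /= in_itv/= ?ax ?xb ?cy ?yd.
  move=> [x' y'] [/=]; rewrite !in_itv/= => /andP[ax' xb'] /andP[cy' yd'].
  by apply: eA; split; rewrite /ball/= ltr_norml; apply/andP; split; lra.
rewrite bigcup_mkcond; apply: countable_bigcupT_measurable.
  exact: countableP.
move=> q; case: ifPn => // _.
by apply: measurableX; exact: measurable_itv.
Qed.

Lemma closed_measurable2 A : closed A -> measurable (A : set (mplane R)).
Proof. by move/closed_openC/open_measurable2/measurableC; rewrite setCK. Qed.

Lemma continuous_measurable_fun2 f : continuous f -> measurable_fun [set: mplane R] f.
Proof.
move=> /continuousP cf; apply: (measurability _ (measurable_realfun.RGenOpens.measurableE R)).
move=> _ [_ [a [b ->] <-]]; rewrite setTI.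
by apply: open_measurable2; apply: cf; exact: itv_open.
Qed.

Lemma bounded_lebesgue2_lty A :
  measurable (A : set (mplane R)) -> bounded_set A -> (lebesgue2 A < +oo)%E.
Proof.
move=> mA [M [_ MA]].
pose J : set R := `[- (M + 1), M + 1]%classic.
have mJ : measurable J by exact: measurable_itv.
have AJ : A `<=` J `*` J.
  move=> [x y] Axy; have := MA (M + 1); rewrite ltrDl ltr01 => /(_ isT _ Axy).
  change (Num.max `|x| `|y| <= M + 1 -> (J `*` J) (x, y)).
  by rewrite ge_max !ler_norml /J /= !in_itv => /andP[].
have ? : measurable (J `*` J : set (mplane R)) by exact: measurableX.
have /le_lt_trans : (lebesgue2 A <= lebesgue2 (J `*` J))%E.
  by apply: le_measure => //; rewrite inE.
have Jfin : (@lebesgue_measure R J < +oo)%E.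
  by rewrite /J lebesgue_measure_itv/=; case: ifP; rewrite ?ltry.
apply; rewrite product_measure1E// lte_mul_pinfty//.
by rewrite ge0_fin_numE.
Qed.

Lemma continuous_compact_support_bounded f (K : set (R * R)) :
  continuous f -> compact K -> (forall x, ~ K x -> f x = 0) ->
  exists M, forall x, `|f x| <= M.
Proof.
move=> cf cK fK.
have /compact_bounded[M [_ Mf]] : compact (f @` K).
  by apply: continuous_compact => //; exact: continuous_subspaceT.
exists (`|M| + 1) => x; have [Kx|/fK ->] := pselect (K x).
  by apply: (Mf (`|M| + 1)); [rewrite (le_lt_trans (ler_norm M))// ltrDl|exists x].
by rewrite normr0 addr_ge0.
Qed.

End plane_measurability.

(* Bundled, so that the spaces below are normed spaces for every [open_set]. *)
Record open_set (R : realType) := OpenSet {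
  oset :> set (R * R) ; oset_open : open oset }.

Section smooth_functions.
Context (R : realType).

Definition basis (i : 'I_2) : R * R := if i == ord0 then (1, 0) else (0, 1).

Definition partial (i : 'I_2) (f : R * R -> R) : R * R -> R := 'D_(basis i) f.

Definition smooth (f : R * R -> R) := forall s : seq 'I_2,
  continuous (foldr partial f s) /\
  forall i x, derivable (foldr partial f s) x (basis i).

Definition tsupport (f : R * R -> R) := closure [set x | f x != 0].

Definition test_function (Omega : set (R * R)) (phi : R * R -> R) :=
  [/\ smooth phi, compact (tsupport phi) & tsupport phi `<=` Omega].

End smooth_functions.

Section H1_functions.
Context (R : realType) (Omega : open_set R).
Implicit Types (f h phi : R * R -> R).

Definition L2 f := measurable_fun (Omega : set (mplane R)) f /\
  lebesgue2.-integrable Omega (fun x => (f x ^+ 2)%:E).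

Definition weak_partial i f h := forall phi, test_function Omega phi ->
  \int[lebesgue2]_(x in Omega) (f x * partial i phi x) =
  - \int[lebesgue2]_(x in Omega) (h x * phi x).

(* A function together with a representative of its weak gradient; the latter
   is determined a.e. by the former. *)
Definition fun_grad := ((R * R -> R) * ('I_2 -> R * R -> R))%type.

Definition fn (w : fun_grad) : R * R -> R := w.1.

Definition grad (w : fun_grad) : 'I_2 -> R * R -> R := w.2.

Definition is_H1 (w : fun_grad) := [/\ L2 (fn w), forall i, L2 (grad w i) &
  forall i, weak_partial i (fn w) (grad w i)].

Let mOmega : measurable (Omega : set (mplane R)).
Proof. by apply: open_measurable2; exact: oset_open. Qed.

Lemma L2_mul_integrable f h : L2 f -> L2 h ->
  lebesgue2.-integrable Omega (EFin \o (fun x => f x * h x)).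
Proof.
move=> [mf If] [mh Ih]; apply: (le_integrable mOmega _ _ (integrableD mOmega If Ih)) => //.
  by apply/measurable_EFinP; exact: measurable_funM.
move=> x _ /=; rewrite lee_fin normrM [leRHS]ger0_norm ?addr_ge0 ?sqr_ge0//.
rewrite -(real_normK (num_real (f x))) -(real_normK (num_real (h x))).
have := sqr_ge0 (`|f x| - `|h x|); have := sqr_ge0 (`|f x| + `|h x|); nra.
Qed.

Lemma L2_0 : L2 (fun=> 0).
Proof.
split; first exact: measurable_cst.
by under eq_fun do rewrite expr0n/=; exact: integrable0.
Qed.

Lemma L2D f h : L2 f -> L2 h -> L2 (fun x => f x + h x).
Proof.
move=> Lf Lh; split; first by apply: measurable_funD; [case: Lf|case: Lh].
have -> : (fun x => ((f x + h x) ^+ 2)%:E) = (fun x => (f x ^+ 2)%:E) \+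
    ((EFin \o (fun x => f x * h x)) \+ (EFin \o (fun x => f x * h x)) \+
     (fun x => (h x ^+ 2)%:E)).
  by apply/funext => x /=; rewrite -!EFinD; congr EFin; ring.
have := L2_mul_integrable Lf Lh.
case: Lf => mf If; case: Lh => mh Ih Ifh.
by do 3 ?[apply: integrableD => //].
Qed.

Lemma L2Z a f : L2 f -> L2 (fun x => a * f x).
Proof.
move=> [mf If]; split; first by apply: measurable_funM.
by under eq_fun do rewrite exprMn EFinM; exact: integrableZl.
Qed.

Lemma compact_support_L2 f (K : set (R * R)) :
  continuous f -> compact K -> (forall x, ~ K x -> f x = 0) -> L2 f.
Proof.
move=> cf cK fK.
have mf := continuous_measurable_fun2 cf.
have [M fM] := continuous_compact_support_bounded cf cK fK.
split; first exact: measurable_funS mf.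
have mK : measurable (K : set (mplane R)).
  apply: closed_measurable2; apply: compact_closed cK.
  exact: norm_hausdorff.
have Kfin : (lebesgue2 K < +oo)%E.
  by apply: bounded_lebesgue2_lty => //; exact: compact_bounded.
have mf2 : measurable_fun [set: mplane R] (fun x => f x ^+ 2) by exact: measurable_funX.
have I2 : lebesgue2.-integrable K (EFin \o (fun x => f x ^+ 2)).
  apply: measurable_bounded_integrable => //; first exact: measurable_funS mf2.
  exists (M ^+ 2); split; first exact: num_real.
  move=> r Mr x Kx /=; rewrite (le_trans _ (ltW Mr))// normrX.
  by rewrite ler_pXn2r// ?nnegrE// (le_trans _ (fM x)).
have : lebesgue2.-integrable setT (EFin \o (fun x => f x ^+ 2)).
  have /integrable_mkcond/= := I2 => /(_ mK).
  apply: eq_integrable => // x _; rewrite patchE; case: ifPn => //.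
  by move=> /negP; rewrite inE => /fK /= ->; rewrite expr0n.
exact: integrableS.
Qed.

Lemma test_function_L2 phi : test_function Omega phi -> L2 phi.
Proof.
move=> [sphi cphi _]; apply: compact_support_L2 cphi _.
  exact: (sphi [::]).1.
move=> x; apply: contra_notP => /eqP phix.
by apply: subset_closure.
Qed.

Lemma partial_test_function_L2 i phi :
  test_function Omega phi -> L2 (partial i phi).
Proof.
move=> [sphi cphi _]; apply: compact_support_L2 cphi _.
  exact: (sphi [:: i]).1.
move=> x xK; rewrite /partial -(derive_cst (0 : R) x (basis R i)).
apply: near_eq_derive.
have : nbhs x (~` tsupport phi).
  by apply: open_nbhs_nbhs; split => //; apply: closed_openC; exact: closed_closure.
apply: filterS => y yK; apply/eqP; apply: contra_notT yK => phiy.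
by apply: subset_closure.
Qed.

Definition in_H1 : {pred fun_grad} := mem [set w | is_H1 w].

Lemma in_H1_submod_closed : submod_closed in_H1.
Proof.
split.
  rewrite inE; split => /= [|i|i phi tphi]; try exact: L2_0.
  rewrite (_ : (fun x => _) = cst 0); last by apply/funext => x; rewrite mul0r.
  rewrite [in RHS](_ : (fun x => _) = cst 0); last by apply/funext => x; rewrite mul0r.
  by rewrite Rintegral_cst// mul0r oppr0.
move=> a u v; rewrite !inE => -[u0 u1 uw] [v0 v1 vw].
split => /= [|i|i phi tphi]; try by apply: L2D => //; exact: L2Z.
have tL := test_function_L2 tphi; have dL := partial_test_function_L2 i tphi.
have E (f h p : R * R -> R) : L2 f -> L2 h -> L2 p ->
    \int[lebesgue2]_(x in Omega) ((a * f x + h x) * p x) =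
    a * \int[lebesgue2]_(x in Omega) (f x * p x) +
    \int[lebesgue2]_(x in Omega) (h x * p x).
  move=> Lf Lh Lp.
  have Ifp := L2_mul_integrable Lf Lp.
  rewrite -RintegralZl// -RintegralD//; last 2 first.
  - move: (L2_mul_integrable (L2Z a Lf) Lp); apply: eq_integrable => //.
    by move=> x _ /=; rewrite mulrA.
  - exact: L2_mul_integrable.
  by apply: eq_Rintegral => x _; rewrite mulrDl mulrA.
rewrite [LHS]E// [X in - X]E// uw// vw//.
by rewrite mulrN opprD.
Qed.

HB.instance Definition _ := GRing.isSubmodClosed.Build _ _ in_H1
  in_H1_submod_closed.

End H1_functions.

Section test_functions.
Context (R : realType).
Implicit Types (f h : R * R -> R).

Lemma partialD i a f h x :
  derivable f x (basis R i) -> derivable h x (basis R i) ->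
  partial i (a *: f + h) x = a * partial i f x + partial i h x.
Proof.
move=> df dh; have daf : derivable (a *: f) x (basis R i) by exact: derivableZ.
by rewrite /partial (deriveD daf dh) (deriveZ _ df).
Qed.

Let foldr_partialD (s : seq 'I_2) a f h : smooth f -> smooth h ->
  foldr (@partial R) (a *: f + h) s =
  a *: foldr (@partial R) f s + foldr (@partial R) h s.
Proof.
move=> sf sh; elim: s => //= i s ->; apply/funext => x.
by rewrite partialD//; [exact: (sf s).2|exact: (sh s).2].
Qed.

Lemma smoothD a f h : smooth f -> smooth h -> smooth (a *: f + h).
Proof.
move=> sf sh s; rewrite foldr_partialD//; split=> [x|i x].
  by apply: cvgD; [apply: cvgZr; exact: (sf s).1|exact: (sh s).1].
by apply: derivableD; [apply: derivableZ; exact: (sf s).2|exact: (sh s).2].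
Qed.

Lemma smooth0 : smooth (0 : R * R -> R).
Proof.
move=> s; have -> : foldr (@partial R) (0 : R * R -> R) s = 0.
  elim: s => //= i s ->; apply/funext => x; exact: (derive_cst (0 : R)).
by split=> [x|i x]; [exact: cvg_cst|exact: derivable_cst].
Qed.

Lemma test_function0 (Omega : set (R * R)) : test_function Omega 0.
Proof.
have -> : test_function Omega 0 = [/\ smooth (0 : R * R -> R),
    compact (@set0 (R * R)) & set0 `<=` Omega].
  rewrite /test_function /tsupport (_ : [set x | _] = set0) ?closure0//.
  by apply/seteqP; split => // x /=; rewrite eqxx.
by split => //; [exact: smooth0|exact: compact0].
Qed.

Lemma test_functionD (Omega : set (R * R)) a f h :
  test_function Omega f -> test_function Omega h ->
  test_function Omega (a *: f + h).
Proof.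
move=> [sf cf fO] [sh ch hO].
have sub : tsupport (a *: f + h) `<=` tsupport f `|` tsupport h.
  rewrite /tsupport -closureU; apply: closureS => x /=.
  apply: contra_neqP => /not_orP[/negP/negPn/eqP fx /negP/negPn/eqP hx].
  by rewrite /= !fctE fx hx scaler0 addr0.
split; first exact: smoothD.
  by apply: subclosed_compact (compactU cf ch) sub; exact: closed_closure.
by move=> x /sub[/fO|/hO].
Qed.

End test_functions.

Section H1.
Context (R : realType) (Omega : open_set R).

Record H1_fun := MkH1_fun {
  H1_fun_val :> fun_grad R ; _ : H1_fun_val \in in_H1 Omega }.

HB.instance Definition _ := [isSub for H1_fun_val].
HB.instance Definition _ := [Choice of H1_fun by <:].
HB.instance Definition _ := [SubChoice_isSubLmodule of H1_fun by <:].

Definition H1_inner (u v : H1_fun) : R := \int[lebesgue2]_(x in Omega)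
  (fn u x * fn v x + \sum_i grad u i x * grad v i x).

Let mOmega : measurable (Omega : set (mplane R)).
Proof. by apply: open_measurable2; exact: oset_open. Qed.

Let H1_funP (u : H1_fun) : is_H1 Omega u.
Proof. by have := valP u; rewrite inE. Qed.

Lemma H1_inner_integrable (u v : H1_fun) : lebesgue2.-integrable Omega
  (EFin \o (fun x => fn u x * fn v x + \sum_i grad u i x * grad v i x)).
Proof.
have [u0 u1 _] := H1_funP u; have [v0 v1 _] := H1_funP v.
rewrite (_ : EFin \o _ = (EFin \o (fun x => fn u x * fn v x)) \+
   (fun x => \sum_i (EFin \o (fun x => (grad u i x * grad v i x)%R)) x)%E).
  apply: integrableD => //; first exact: L2_mul_integrable.
  by apply: integrable_sum => // i _; exact: L2_mul_integrable.
by apply/funext => x /=; rewrite sumEFin EFinD.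
Qed.

Let H1_innerC u v : H1_inner u v = H1_inner v u.
Proof.
apply: eq_Rintegral => x _; rewrite mulrC; congr (_ + _).
by apply: eq_bigr => i _; rewrite mulrC.
Qed.

Let H1_innerDl u v w : H1_inner (u + v) w = H1_inner u w + H1_inner v w.
Proof.
rewrite /H1_inner -RintegralD//; try exact: H1_inner_integrable.
apply: eq_Rintegral => x _ /=; rewrite addrACA -big_split/= -mulrDl.
by congr (_ + _); apply: eq_bigr => i _; rewrite -mulrDl.
Qed.

Let H1_innerZl a u v : H1_inner (a *: u) v = a * H1_inner u v.
Proof.
rewrite /H1_inner -RintegralZl//; try exact: H1_inner_integrable.
apply: eq_Rintegral => x _ /=; rewrite mulrDr mulrA mulr_sumr.
by congr (_ + _); apply: eq_bigr => i _; rewrite mulrA.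
Qed.

Let H1_inner_ge0 u : 0 <= H1_inner u u.
Proof.
apply: Rintegral_ge0 => x _; apply: addr_ge0; first exact: sqr_ge0.
by apply: sumr_ge0 => i _; exact: sqr_ge0.
Qed.

Definition H1_semi_inner :=
  SemiInner H1_innerC H1_innerDl H1_innerZl H1_inner_ge0.

Definition H1 := sip_quot H1_semi_inner.
HB.instance Definition _ := NormedModule.on H1.

(* The classes of the functions of [C_c^oo(Omega)]; [H10] is their closure. *)
Definition H1_test : set H1 :=
  [set \pi_H1%qT u | u in [set u : H1_fun |
    test_function Omega (fn u) /\ forall i, grad u i = partial i (fn u)]].

Definition in_H10 : {pred H1} := mem (closure H1_test).

Lemma H1_test_submod_closed : H1_test 0 /\
  forall a u v, H1_test u -> H1_test v -> H1_test (a *: u + v).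
Proof.
split.
  exists 0 => //=; split; first exact: test_function0.
  by move=> i; apply/funext => x; rewrite /partial derive_cst.
move=> a _ _ [u [tu gu] <-] [v [tv gv] <-].
exists (a *: u + v); last by rewrite sip_piD sip_piZ.
have E : H1_fun_val (a *: u + v) = a *: H1_fun_val u + H1_fun_val v.
  by rewrite -[LHS]/(val _) linearP.
have fE : fn (a *: u + v : H1_fun) = a *: fn u + fn v by rewrite E.
have gE i : grad (a *: u + v : H1_fun) i = a *: grad u i + grad v i by rewrite E.
split; first by rewrite fE; exact: test_functionD.
move=> i; rewrite gE fE; apply/funext => x.
have du := (let: And3 s _ _ := tu in s [::]).2 i x.
have dv := (let: And3 s _ _ := tv in s [::]).2 i x.
by rewrite (partialD a du dv) -gu -gv.
Qed.

Lemma in_H10_submod_closed : submod_closed in_H10.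
Proof.
have [t0 tD] := H1_test_submod_closed.
split; first by rewrite inE; exact: subset_closure.
move=> a u v; rewrite !inE => cu cv B /nbhs_ballP[e /= e0 eB].
have d0 : 0 < e / (2 * (`|a| + 1)).
  by rewrite divr_gt0// mulr_gt0// ltr_wpDl.
have [u' [tu' uu']] := cu _ (nbhsx_ballx u _ d0).
have [v' [tv' vv']] := cv _ (nbhsx_ballx v (e / 2) (divr_gt0 e0 (ltr0n _ 2))).
exists (a *: u' + v'); split; first exact: tD.
apply: eB; move: uu' vv'; rewrite -!ball_normE /= => uu' vv'.
rewrite opprD addrACA -scalerBr (le_lt_trans (ler_normD _ _))// normrZ.
have : `|a| * `|u - u'| <= e / 2.
  rewrite (le_trans (ler_wpM2l _ (ltW uu')))//.
  rewrite invfM (mulrA e) mulrCA ler_piMr//; first by rewrite ltW// divr_gt0.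
  by rewrite ler_pdivrMr ?mul1r ?lerDl// ltr_wpDl.
move: vv'; lra.
Qed.

HB.instance Definition _ := GRing.isSubmodClosed.Build _ _ in_H10
  in_H10_submod_closed.

Record H10 := MkH10 { H10_val :> H1 ; _ : H10_val \in in_H10 }.

HB.instance Definition _ := [isSub for H10_val].
HB.instance Definition _ := [Choice of H10 by <:].
HB.instance Definition _ := [SubChoice_isSubLmodule of H10 by <:].

Let H10_normD (u v : H10) : `|(u + v : H10) : H1| <= `|u : H1| + `|v : H1|.
Proof. exact: ler_normD. Qed.

Let H10_normZ a (u : H10) : `|(a *: u : H10) : H1| = `|a| * `|u : H1|.
Proof. exact: normrZ. Qed.

Let H10_norm0_eq0 (u : H10) : `|u : H1| = 0 -> u = 0.
Proof. by move=> /normr0_eq0 u0; exact: val_inj. Qed.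

HB.instance Definition _ := Lmodule_isNormed.Build R H10
  H10_normD H10_normZ H10_norm0_eq0.

(* A representative; it is only determined a.e. in [Omega]. *)
Definition H10_fun_grad (u : H10) : fun_grad R :=
  (repr (H10_val u) : H1_fun).

End H1.

Section operators.
Context (R : realType).

Definition dual (V : normedModType R) : set (V -> R) :=
  [set F | linear (F : V -> R^o) /\ continuous (F : V -> R^o)].

(* [weighted_laplacian k u] is the functional [v |-> <- div (k grad u), v>]. *)
Definition weighted_laplacian (Omega : open_set R) (k : R * R -> R)
    (u v : H10 Omega) : R :=
  \int[lebesgue2]_(x in Omega) (k x *
    \sum_i grad (H10_fun_grad u) i x * grad (H10_fun_grad v) i x).

Definition has_bounded_inverse (V : normedModType R) (S : V -> V) :=
  exists S' : V -> V,
    [/\ linear S', continuous S', cancel S S' & cancel S' S].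

(* The complexification of a real space [V] is [V * V], where [(u, v)] stands
   for [u + iv]. *)
Definition cscale (V : normedModType R) (a : R[i]) (z : V * V) : V * V :=
  (complex.Re a *: z.1 - complex.Im a *: z.2,
   complex.Im a *: z.1 + complex.Re a *: z.2).

Definition complexify (V : normedModType R) (T : V -> V) (z : V * V) : V * V :=
  (T z.1, T z.2).

(* For real [a] the operator acts on the real space [V] itself, for non-real [a]
   on the complexification. *)
Definition resolvent_set (V : normedModType R) (T : V -> V) : set R[i] :=
  [set a | if complex.Im a == 0
           then has_bounded_inverse (fun x : V => complex.Re a *: x - T x)
           else has_bounded_inverse
                  (fun z : V * V => cscale a z - complexify T z)].

Definition spectrum (V : normedModType R) (T : V -> V) : set R[i] :=
  ~` resolvent_set T.

Definition uniformly_positive (A : set (R * R)) (f : R * R -> R) :=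
  exists2 c, 0 < c & forall x, A x -> c <= f x.

(* Near each boundary point [p], in some coordinates [(a, b)] obtained by
   translating the origin to [p] and rotating the axes to the orthonormal frame
   [(c, s), (- s, c)], the set is the part of a rectangle above the graph of a
   Lipschitz function. *)
Definition lipschitz_boundary (Omega : set (R * R)) :=
  forall p, (closure Omega `\` interior Omega) p ->
  exists c s r h L (gamma : R -> R),
    [/\ c ^+ 2 + s ^+ 2 = 1, 0 < r, 0 < h, L.-lipschitz (gamma : R^o -> R^o) &
      forall a b, `|a| < r -> `|b| < h ->
        Omega (p.1 + a * c - b * s, p.2 + a * s + b * c) <-> gamma a < b].

End operators.
Arguments dual {R} V.

(* Main.v *)
(* For a continuous weight [w] put [W_w u v = \int w grad u . grad v] on [H10];
   it is bounded, and by the Poincare inequality it is coercive as soon as [w]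
   is uniformly positive.  As [H10] is complete, [W_w] then represents every
   continuous functional, so [B = W_g] is invertible, and [T = B^-1 A] is
   self-adjoint for [W_g]: [W_g (T u) v = W_k u v].  For real [l],
   [W_g ((l - T) u) v = W_(l g - k) u v]; for non-real [l], [l - T] is inverted
   on the complexification through [(Re l - T) ^ 2 + (Im l) ^ 2].  If a real [l] lies outside the range of
   [k / g], then [l g - k] or its opposite is uniformly positive, whence [l - T]
   is invertible; if [l] is a value of [k / g], then [l g - k] is small on some
   small box of [Omega], and a bump function supported there is an approximate
   eigenfunction.  The range of [k / g] is an interval, [closure Omega] being
   compact and connected. *)
Require Import Defs.
From HB Require Import structures.
From mathcomp Require Import all_boot all_order all_algebra complex.
From mathcomp Require Import all_classical all_reals all_analysis.
From mathcomp Require Import measurable_realfun.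
From mathcomp Require Import ring lra.
Import Order.TTheory GRing.Theory Num.Theory.
Import numFieldNormedType.Exports.
Set Implicit Arguments.
Unset Strict Implicit.
Unset Printing Implicit Defensive.
Local Open Scope classical_set_scope.
Local Open Scope ring_scope.

(** * Symmetric bounded forms *)

(** Off the interval the proof needs completeness, while [H10] is built as a closed subspace of a
    quotient of functions paired with weak gradients. Completeness is asked only for sequences with
    increments at most [2 ^- n]: near-minimisers in the Riesz argument can be chosen to satisfy
    this, and it makes functions and gradients converge almost everywhere. Coercivity comes from
    integration by parts, available for test functions, and is carried to [H10] by density. On the
    interval the argument is locality. The gradient of a bump vanishes off its box, so only the
    values of [l g - k] on that box enter the form, and the error is measured against the norm of
    the bump itself. Hence one bump per tolerance suffices, however steep it is, with neither
    oscillation nor rescaling. A value of [k / g] taken at a boundary point is handled in the same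
    way, because continuity up to the closure gives nearly the same value at nearby points of
    [Omega]. *)

Lemma discriminant_le (R : realType) (a x y : R) : 0 <= y ->
  (forall t, 0 <= a + 2 * t * x + t ^+ 2 * y) -> x ^+ 2 <= a * y.
Proof.
move=> y0 key.
have [yy0|yy0] := eqVneq y 0.
  rewrite yy0 mulr0; have [->|xy0] := eqVneq x 0; first by rewrite expr0n.
  (* For [y = 0] the polynomial is affine; at this [t] it takes the value [-1]. *)
  have := key (- (a + 1) / (2 * x)).
  rewrite yy0 mulr0 addr0.
  have -> : 2 * (- (a + 1) / (2 * x)) * x = - (a + 1) by field.
  by rewrite opprD addrA subrr add0r oppr_ge0 ler10.
have yy_gt0 : 0 < y by rewrite lt0r yy0.
have := key (- (x / y)).
have -> : a + 2 * - (x / y) * x + (- (x / y)) ^+ 2 * y = (a * y - x ^+ 2) / y.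
  by field.
by rewrite pmulr_lge0 ?invr_gt0// subr_ge0.
Qed.

(** The [+ 1] keeps the denominator positive when [x = 0], so continuity estimates with a possibly
    vanishing constant need no case distinction. *)
Lemma mul_divD1_le (R : realType) (x e : R) : 0 <= x -> 0 <= e ->
  x * (e / (x + 1)) <= e.
Proof.
move=> x0 e0; have x1 : 0 < x + 1 by rewrite ltr_wpDl.
by rewrite mulrA ler_pdivrMr// mulrC ler_wpM2l// lerDl.
Qed.

Section bounded_forms.
Context (R : realType) (V : normedModType R).
Implicit Types (b : V -> V -> R) (u v w : V).

(** Symmetry gives linearity in the second argument. The sign of [M] is left free; where it matters,
    [form_bound_norm] passes to the absolute value. *)
Record bounded_form (b : V -> V -> R) (M : R) : Prop := BoundedForm {
  bformC : forall u v, b u v = b v u ;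
  bformDl : forall u v w, b (u + v) w = b u w + b v w ;
  bformZl : forall a u v, b (a *: u) v = a * b u v ;
  bform_le : forall u v, `|b u v| <= M * (`|u| * `|v|) }.

Definition coercive b c := 0 < c /\ forall u, c * `|u| ^+ 2 <= b u u.

Section theory.
Context (b : V -> V -> R) (M : R) (Hb : bounded_form b M).

Lemma bformNl u v : b (- u) v = - b u v.
Proof. by rewrite -scaleN1r (bformZl Hb) mulN1r. Qed.

Lemma bformBl u v w : b (u - v) w = b u w - b v w.
Proof. by rewrite (bformDl Hb) bformNl. Qed.

Lemma bformDr u v w : b w (u + v) = b w u + b w v.
Proof. by rewrite (bformC Hb) (bformDl Hb) !(bformC Hb w). Qed.

Lemma bformZr a u v : b v (a *: u) = a * b v u.
Proof. by rewrite (bformC Hb) (bformZl Hb) (bformC Hb v). Qed.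

Lemma bformBr u v w : b w (u - v) = b w u - b w v.
Proof. by rewrite (bformC Hb) bformBl !(bformC Hb w). Qed.

Lemma bform_cvg (u : nat -> V) l v : u @ \oo --> l ->
  b (u n) v @[n --> \oo] --> b l v.
Proof.
move=> ul; apply/cvgrPdist_le => /= e e0.
have d0 : 0 < e / (`|M| * `|v| + 1) by rewrite divr_gt0// ltr_wpDl.
move/cvgrPdist_le : ul => /(_ _ d0); apply: filterS => n un.
rewrite -bformBl (le_trans (bform_le Hb _ _))//.
rewrite mulrCA mulrC (le_trans (ler_wpM2r (normr_ge0 _) (ler_wpM2r (normr_ge0 v) (ler_norm M))))//.
rewrite (le_trans (ler_wpM2l _ un)) ?mulr_ge0//.
by apply: mul_divD1_le; rewrite ?mulr_ge0// ltW.
Qed.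

Lemma bform_dual u : dual V (b u).
Proof.
split; first by move=> a v w; rewrite bformDr bformZr.
move=> v; apply/cvgrPdist_le => /= e e0.
have d0 : 0 < e / (`|M| * `|u| + 1) by rewrite divr_gt0// ltr_wpDl.
near=> w; rewrite -bformBr (le_trans (bform_le Hb _ _))//.
rewrite mulrA (le_trans (ler_wpM2r (normr_ge0 _) (ler_wpM2r (normr_ge0 u) (ler_norm M))))//.
have wv : `|v - w| <= e / (`|M| * `|u| + 1).
  by near: w; exact: cvgr_dist_le.
rewrite (le_trans (ler_wpM2l _ wv)) ?mulr_ge0//.
by apply: mul_divD1_le; rewrite ?mulr_ge0// ltW.
Unshelve. all: by end_near. Qed.

End theory.

Lemma dual_bounded (F : V -> R) : dual V F ->
  exists2 K, 0 < K & forall v, `|F v| <= K * `|v|.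
Proof.
move=> [lF cF].
pose FL : {linear V -> R^o} :=
  HB.pack (F : V -> R^o) (GRing.isLinear.Build _ _ _ _ (F : V -> R^o) lF).
have := @continuous_linear_bounded R V R^o 0 FL (cF 0).
move/linear_boundedP => /pinfty_ex_gt0 [K K0 HK].
by exists K.
Qed.

(** With geometric increments the series of differences converges absolutely almost everywhere, so
    in [L2] a limit can be built pointwise, without extracting subsequences. *)
Definition rapidly_complete := forall u : nat -> V,
  (forall n, `|u n.+1 - u n| <= 2 ^- n) -> exists l : V, u @ \oo --> l.

Lemma coercive_eq0 b M c u : bounded_form b M -> coercive b c ->
  (forall v, b u v = 0) -> u = 0.
Proof.
move=> Hb [c0 cb] bu; apply/eqP; rewrite -normr_eq0 -sqrf_eq0.
have := cb u; rewrite bu => cu.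
by rewrite eq_le sqr_ge0 andbT -(pmulr_rle0 _ c0).
Qed.

(* The minimiser of [b v v - 2 F v]. *)
Lemma riesz b M c (F : V -> R) : rapidly_complete -> bounded_form b M ->
  coercive b c -> dual V F -> exists u, forall v, b u v = F v.
Proof.
move=> CV Hb [c0 cb] dF; have [K K0 FK] := dual_bounded dF.
have FZD a u v : F (a *: u + v) = a * F u + F v by exact: dF.1.
have F0 : F 0 = 0 by have := FZD (-1) 0 0; rewrite scaler0 addr0; lra.
have FZ a u : F (a *: u) = a * F u by rewrite -[a *: u]addr0 FZD F0 addr0.
have FD u v : F (u + v) = F u + F v by rewrite -[u]scale1r FZD !scale1r mul1r.
pose J v := b v v - 2 * F v.
(* Completing the square in [|v|]: [c |v|^2 - 2 K |v|] is at least [- K^2 / c]. *)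
have Jlb v : - (K ^+ 2 / c) <= J v.
  have h1 := cb v; have /ler_normlP[_ h2] := FK v.
  have : 0 <= (c * `|v| - K) ^+ 2 / c by rewrite divr_ge0 ?sqr_ge0// ltW.
  have -> : (c * `|v| - K) ^+ 2 / c = c * `|v| ^+ 2 - 2 * (K * `|v|) + K ^+ 2 / c.
    by field; exact: lt0r_neq0.
  rewrite /J; lra.
have Jinf : has_inf (range J).
  split; first by exists (J 0), 0.
  by exists (- (K ^+ 2 / c)) => _ [v _ <-].
pose I := inf (range J).
have IJ v : I <= J v by apply: ge_inf; [exact: Jinf.2|exists v].
(* Chosen so that the parallelogram identity below yields exactly [|u n.+1 - u n|^2 <= 4 ^- n]: it
   bounds [c |u n.+1 - u n|^2] by [4 * d n]. *)
pose d n : R := c / 4 * (4 ^- n).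
have d0 n : 0 < d n by rewrite mulr_gt0// divr_gt0.
have /choice[u uJ] n : exists v, J v <= I + d n.
  have [_ [v _ <-] vI] := inf_adherent (d0 n) Jinf.
  by exists v; exact: ltW.
(* The parallelogram law; the linear terms cancel because [F] at the midpoint is the mean of its
   values. *)
have Jpar v w : b (v - w) (v - w) = 2 * (J v + J w - 2 * J (2^-1 *: (v + w))).
  rewrite /J !(bformBl Hb) !(bformBr Hb) (bformZl Hb) (bformZr Hb) FZ.
  by rewrite !(bformDl Hb) !(bformDr Hb) FD (bformC Hb w v); field.
have [n|l ul] := CV u.
  have := cb (u n.+1 - u n); rewrite Jpar => cu.
  have dn : d n.+1 <= d n.
    rewrite ler_pM2l ?divr_gt0// lef_pV2 ?posrE ?exprn_gt0//.
    by rewrite exprS ler_peMl ?exprn_ge0// ler1n.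
  have : `|u n.+1 - u n| ^+ 2 <= (2 ^- n) ^+ 2.
    have -> : (2 ^- n : R) ^+ 2 = 4 ^- n by rewrite exprVn -exprM mulnC exprM -natrX.
    rewrite -(ler_pM2l c0) (le_trans cu)//.
    have -> : c * 4 ^- n = 4 * d n by rewrite /d; field; rewrite expf_neq0.
    have := IJ (2^-1 *: (u n.+1 + u n)); have := uJ n; have := uJ n.+1; lra.
  by rewrite ler_pXn2r// nnegrE// invr_ge0 exprn_ge0.
exists l => v.
(* Near-minimality of [u n] along the line [u n + t *: v] makes
   [d n + 2 t (b (u n) v - F v) + t^2 b v v] nonnegative for all [t]. The discriminant bounds the
   first variation, which therefore vanishes in the limit. *)
have key n : (b (u n) v - F v) ^+ 2 <= d n * b v v.
  apply: discriminant_le => [|t].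
    by apply: le_trans (cb v); rewrite mulr_ge0 ?sqr_ge0// ltW.
  have := IJ (u n + t *: v); have := uJ n; rewrite /J.
  rewrite !(bformDl Hb) !(bformDr Hb) !(bformZl Hb) !(bformZr Hb) FD FZ (bformC Hb v).
  move=> h1 h2; rewrite -subr_ge0 in h1; rewrite -subr_ge0 in h2.
  by have := addr_ge0 h1 h2; congr (0 <= _); ring.
have c1 : (b (u n) v - F v) ^+ 2 @[n --> \oo] --> (b l v - F v) ^+ 2.
  have h : b (u n) v - F v @[n --> \oo] --> b l v - F v.
    by apply: cvgB; [exact: (bform_cvg Hb)|exact: cvg_cst].
  by rewrite expr2; under eq_fun do rewrite expr2; exact: cvgM.
have c2 : d n * b v v @[n --> \oo] --> (0 : R).
  rewrite -(mul0r (b v v)); apply: cvgMr_tmp; rewrite -(mulr0 (c / 4)).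
  apply: cvgMl_tmp; under eq_fun do rewrite -exprVn.
  by apply: cvg_expr; rewrite ger0_norm ?invr_ge0// invf_lt1// ltr1n.
have : (b l v - F v) ^+ 2 <= 0.
  by apply: ler_cvg_to c1 c2 _; near=> n; exact: key.
by move=> h; apply/eqP; rewrite -subr_eq0 -sqrf_eq0 eq_le h sqr_ge0.
Unshelve. all: by end_near. Qed.

End bounded_forms.

Lemma bounded_below_inverse (R : realType) (V : normedModType R) (S : V -> V) c :
  linear S -> 0 < c -> (forall x, c * `|x| <= `|S x|) ->
  (forall y, exists x, S x = y) -> has_bounded_inverse S.
Proof.
move=> lS c0 Sc /choice[S' S'K].
have S0 : S 0 = 0.
  by have := lS (-1) 0 0; rewrite scaler0 addr0 scaleN1r addNr.
have SB x y : S (x - y) = S x - S y by have := lS (-1) y x; rewrite !scaleN1r !(addrC (- _)).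
have Sinj x y : S x = S y -> x = y.
  move=> e; apply/eqP; rewrite -subr_eq0 -normr_le0 -(pmulr_rle0 _ c0).
  by rewrite (le_trans (Sc _))// SB e subrr normr0.
have lS' : linear S' by move=> a x y; apply: Sinj; rewrite lS !S'K.
exists S'; split => //; last by move=> x; apply: Sinj; rewrite S'K.
pose L : {linear V -> V} := HB.pack S' (GRing.isLinear.Build _ _ _ _ S' lS').
suff : continuous L by [].
apply: bounded_linear_continuous; apply/linear_boundedP.
exists c^-1; split; first exact: num_real.
move=> r /ltW cr y; apply: le_trans (ler_wpM2r (normr_ge0 y) cr).
by rewrite ler_pdivlMl// (le_trans (Sc _))//= S'K.
Qed.

Lemma bounded_inverse_below (R : realType) (V : normedModType R) (S : V -> V) :
  has_bounded_inverse S -> exists2 K, 0 < K & forall x, `|x| <= K * `|S x|.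
Proof.
move=> [S' [lS' cS' SK _]].
pose L : {linear V -> V} := HB.pack S' (GRing.isLinear.Build _ _ _ _ S' lS').
have := @continuous_linear_bounded R V V 0 L (cS' 0).
move/linear_boundedP => /pinfty_ex_gt0 [K K0 HK].
by exists K => // x; rewrite -{1}(SK x); exact: HK.
Qed.

(** Cancels one factor [t], a norm that may be zero, from an estimate obtained by testing a form
    with a vector itself. *)
Lemma mul_sqr_le (R : realType) (c K t x : R) : 0 <= t -> 0 <= K -> 0 <= x ->
  c * t ^+ 2 <= K * (x * t) -> c * t <= K * x.
Proof.
rewrite le_eqVlt => /orP[/eqP <- K0 x0 _|t0 _ _]; first by rewrite mulr0 mulr_ge0.
by rewrite expr2 !mulrA ler_pM2r.
Qed.

(** * Resolvent of an operator represented by two forms *)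

Section form_operator.
Context (R : realType) (V : normedModType R).
Context (b a : V -> V -> R) (Mb Ma cb : R) (T : V -> V).
Hypotheses (CV : rapidly_complete V) (Hb : bounded_form b Mb)
  (Cb : coercive b cb) (Ha : bounded_form a Ma)
  (bT : forall u v, b (T u) v = a u v).

Lemma form_eq u w : (forall v, b u v = b w v) -> u = w.
Proof.
move=> uw; apply/eqP; rewrite -subr_eq0; apply/eqP.
by apply: (coercive_eq0 Hb Cb) => v; rewrite (bformBl Hb) uw subrr.
Qed.

Lemma form_operator_linear : linear T.
Proof.
move=> x u v; apply: form_eq => w.
by rewrite (bformDl Hb) (bformZl Hb) !bT (bformDl Ha) (bformZl Ha).
Qed.

Lemma form_bound_norm (f : V -> V -> R) (M : R) :
  bounded_form f M -> bounded_form f `|M|.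
Proof.
move=> [fC fD fZ f_le]; split => // u v.
by rewrite (le_trans (f_le u v))// ler_wpM2r ?mulr_ge0// ler_norm.
Qed.

(** Testing with [T u] itself: [cb |T u|^2 <= b (T u) (T u) = a u (T u)]. *)
Lemma form_operator_bounded u : cb * `|T u| <= `|Ma| * `|u|.
Proof.
apply: mul_sqr_le => //; rewrite (le_trans (Cb.2 _))// bT.
by rewrite (le_trans (ler_norm _))// (bform_le (form_bound_norm Ha)).
Qed.

Let S (l : R) u := l *: u - T u.

Let S_linear l : linear (S l).
Proof.
move=> x u v; rewrite /S form_operator_linear scalerDr scalerBr !scalerA.
by rewrite (mulrC l) opprD addrACA.
Qed.

Let bS l u v : b (S l u) v = l * b u v - a u v.
Proof. by rewrite /S (bformBl Hb) (bformZl Hb) bT. Qed.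

Let S_sym l u v : b (S l u) v = b u (S l v).
Proof.
by rewrite (bformC Hb u) !bS (bformC Hb u) (bformC Ha u).
Qed.

Let S_bounded l : exists2 K, 0 <= K & forall u, `|S l u| <= K * `|u|.
Proof.
exists (`|l| + `|Ma| / cb) => [|u]; first by rewrite addr_ge0// divr_ge0// ltW// Cb.1.
rewrite (le_trans (ler_normB _ _))// normrZ mulrDl lerD2l.
by rewrite mulrAC ler_pdivlMr ?Cb.1// mulrC form_operator_bounded.
Qed.

Let form_sub l s : exists M, bounded_form (fun u v => s * (l * b u v - a u v)) M.
Proof.
exists (`|s| * (`|l| * `|Mb| + `|Ma|)); split.
- by move=> u v; rewrite (bformC Hb) (bformC Ha).
- by move=> u v w; rewrite (bformDl Hb) (bformDl Ha); ring.
- by move=> x u v; rewrite (bformZl Hb) (bformZl Ha); ring.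
- move=> u v; rewrite normrM -mulrA ler_wpM2l// mulrDl.
  rewrite (le_trans (ler_normB _ _))// normrM lerD//; last first.
    exact: (bform_le (form_bound_norm Ha)).
  by rewrite -mulrA ler_wpM2l// (bform_le (form_bound_norm Hb)).
Qed.

(** The form represents [s (l - T)] with respect to [b], and [s] is meant to be a sign. Coercivity
    bounds [l - T] from below; the Riesz argument applied to [b (s *: w)] gives a preimage of
    [w]. *)
Lemma real_resolvent l s c : s != 0 ->
  coercive (fun u v => s * (l * b u v - a u v)) c ->
  has_bounded_inverse (fun u => l *: u - T u).
Proof.
move=> s0 Cd; have [M Hd] := form_sub l s; have [c0 cd] := Cd.
have K0 : 0 < `|s| * `|Mb| + 1 by rewrite ltr_wpDl ?mulr_ge0.
apply: (@bounded_below_inverse _ _ _ (c / (`|s| * `|Mb| + 1))).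
- exact: (S_linear l).
- by rewrite divr_gt0.
- move=> u; rewrite mulrAC ler_pdivrMr// (mulrC `|_|).
  apply: mul_sqr_le; rewrite ?(ltW K0)// (le_trans (cd u))// -bS.
  rewrite (le_trans (ler_norm _))// normrM mulrDl -mulrA mul1r ler_wpDr ?mulr_ge0//.
  by rewrite ler_wpM2l// (bform_le (form_bound_norm Hb)).
- move=> w; have [u Hu] := riesz CV Hd Cd (bform_dual Hb (s *: w)).
  exists u; apply: form_eq => v; apply: (mulfI s0).
  by rewrite [LHS]/= -[X in s * b X v]/(S l u) bS Hu (bformZl Hb).
Qed.

(** The weak estimate may be tested with [v = l u - T u], and coercivity turns it into a norm
    estimate. The tolerance [cb / (2 K)] gives [|l u - T u| <= |u| / (2 K)], which for nonzero [u]
    contradicts the bound [|u| <= K |l u - T u|] provided by an inverse. *)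
Lemma approximate_eigenvalue l :
  (forall e, 0 < e -> exists u, u != 0 /\
    forall v, `|l * b u v - a u v| <= e * (`|u| * `|v|)) ->
  ~ has_bounded_inverse (fun u => l *: u - T u).
Proof.
move=> He /bounded_inverse_below[K K0 HK]; have [cb0 cbb] := Cb.
have [|u [u0 Hu]] := He (cb / (2 * K)); first by rewrite divr_gt0 ?mulr_gt0.
have h1 : cb * `|S l u| <= cb / (2 * K) * `|u|.
  apply: mul_sqr_le => //; first by rewrite ltW ?divr_gt0 ?mulr_gt0.
  by rewrite (le_trans (cbb _))// bS (le_trans (ler_norm _)).
have h2 := HK u; rewrite -/(S l u) in h2.
have : cb / (2 * K) * `|u| <= cb / 2 * `|S l u|.
  rewrite -ler_pdivlMl ?divr_gt0 ?mulr_gt0// (le_trans h2)//.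
  rewrite le_eqVlt; apply/orP; left; apply/eqP; field.
  by rewrite !lt0r_neq0.
move/(le_trans h1); rewrite ler_pM2r; last first.
  have : 0 < K * `|S l u| by apply: lt_le_trans h2; rewrite normr_gt0.
  by rewrite pmulr_rgt0.
lra.
Qed.

(* With [S = x - T], the system [S u - y v = f], [y u + S v = h] is solved by
   inverting the coercive operator [S ^ 2 + y ^ 2]. *)
Lemma nonreal_resolvent (l : R[i]) : complex.Im l != 0 ->
  has_bounded_inverse (fun z : V * V => Defs.cscale l z - complexify T z).
Proof.
case: l => x y /= y0.
have E (z : V * V) : Defs.cscale (x +i* y)%C z - complexify T z =
    (S x z.1 - y *: z.2, y *: z.1 + S x z.2).
  by rewrite /cscale /complexify /S/=; congr (_, _); rewrite ?addrA// addrAC.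
have -> : (fun z : V * V => Defs.cscale (x +i* y)%C z - complexify T z) =
    (fun z => (S x z.1 - y *: z.2, y *: z.1 + S x z.2)) by apply/funext.
clear E; move: (S x) (S_linear x) (S_sym x) (S_bounded x) => Q Q_linear Q_sym [KS KS0 SK].
have [cb0 cbb] := Cb.
have Mb1 : 0 < `|Mb| + 1 by rewrite ltr_wpDl.
pose N (z : V * V) := (Q z.1 - y *: z.2, y *: z.1 + Q z.2).
have SB u v : Q (u - v) = Q u - Q v.
  by have := Q_linear (-1) v u; rewrite !scaleN1r !(addrC (- _)).
have SZ r u : Q (r *: u) = r *: Q u.
  have S0 : Q 0 = 0 by have := SB 0 0; rewrite subrr => ->; rewrite subrr.
  by rewrite -[r *: u]addr0 Q_linear S0 addr0.
have SD u v : Q (u + v) = Q u + Q v.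
  by rewrite -[u]scale1r Q_linear !scale1r.
(* By symmetry of [Q], this is the form of [Q ^ 2 + y ^ 2] with respect to [b]; the second summand
   alone makes it coercive. *)
pose e u v := b (Q u) (Q v) + y ^+ 2 * b u v.
have He : bounded_form e (`|Mb| * (KS * KS) + y ^+ 2 * `|Mb|).
  split.
  - by move=> u v; rewrite /e (bformC Hb (Q u)) (bformC Hb u).
  - by move=> u v w; rewrite /e SD !(bformDl Hb); ring.
  - by move=> r u v; rewrite /e SZ !(bformZl Hb); ring.
  - move=> u v; rewrite /e (le_trans (ler_normD _ _))// mulrDl lerD//.
      rewrite (le_trans (bform_le (form_bound_norm Hb) _ _))// -mulrA.
      rewrite ler_wpM2l// (_ : _ * _ * _ = (KS * `|u|) * (KS * `|v|)); last by ring.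
      by rewrite ler_pM.
    rewrite normrM ger0_norm ?sqr_ge0// -mulrA ler_wpM2l ?sqr_ge0//.
    exact: (bform_le (form_bound_norm Hb)).
have b0 w : b 0 w = 0 by rewrite -(scale0r 0) (bformZl Hb) mul0r.
have y2 : 0 < y ^+ 2 by rewrite lt0r sqrf_eq0 y0 sqr_ge0.
have Ce : coercive e (y ^+ 2 * cb).
  split; first by rewrite mulr_gt0.
  move=> u; rewrite /e -mulrA; apply: ler_wpDl; last by rewrite ler_wpM2l// ltW.
  by apply: le_trans (cbb _); rewrite mulr_ge0 ?sqr_ge0// ltW.
have e_sol w : exists u, Q (Q u) + y ^+ 2 *: u = w.
  have [u Hu] := riesz CV He Ce (bform_dual Hb w).
  exists u; apply: form_eq => v; rewrite -Hu /e (bformDl Hb) (bformZl Hb).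
  by rewrite (Q_sym (Q u)).
have e_inj u : Q (Q u) + y ^+ 2 *: u = 0 -> u = 0.
  move=> u0; apply: (coercive_eq0 He Ce) => v; rewrite /e -Q_sym -(bformZl Hb) -(bformDl Hb) u0.
  exact: b0.
(* The factor 2 comes from [|z.1| + |z.2| <= 2 |z|] in the maximum norm of the product. *)
apply: (@bounded_below_inverse _ _ N (`|y| * cb / (2 * (`|Mb| + 1)))).
- move=> r [u1 v1] [u2 v2]; rewrite /N /= SD SZ SD SZ.
  congr (_, _) => /=.
    by rewrite (scalerBr r (Q u1)) (scalerDr y) !scalerA (mulrC y) opprD addrACA.
  by rewrite (scalerDr y) (scalerDr r (y *: u1)) !scalerA (mulrC y) addrACA.
- by rewrite divr_gt0 ?mulr_gt0 ?normr_gt0.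
- move=> z; set n := `|N z|.
  have n1 : `|Q z.1 - y *: z.2| <= n by rewrite /n prod_normE/= le_max lexx.
  have n2 : `|y *: z.1 + Q z.2| <= n by rewrite /n prod_normE/= le_max lexx orbT.
  (* Pairing the second component with [z.1] and the first with [- z.2] cancels the terms in [Q],
     which is symmetric. This is the usual argument that the imaginary part of [l] alone controls
     [l - T]. *)
  have key : y * (b z.1 z.1 + b z.2 z.2) =
      b (y *: z.1 + Q z.2) z.1 - b (Q z.1 - y *: z.2) z.2.
    rewrite (bformDl Hb) (bformBl Hb) !(bformZl Hb) (Q_sym z.2) (bformC Hb z.2 (Q _)).
    by ring.
  have h : `|y| * cb * (`|z.1| ^+ 2 + `|z.2| ^+ 2) <= `|Mb| * n * (`|z.1| + `|z.2|).
    rewrite -mulrA (@le_trans _ _ (`|y * (b z.1 z.1 + b z.2 z.2)|))//.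
      rewrite normrM ler_wpM2l// (le_trans _ (ler_norm _))// mulrDr lerD//.
    rewrite key (le_trans (ler_normB _ _))// mulrDr lerD//.
      rewrite (le_trans (bform_le (form_bound_norm Hb) _ _))// -mulrA ler_wpM2l//.
      by rewrite ler_wpM2r.
    rewrite (le_trans (bform_le (form_bound_norm Hb) _ _))// -mulrA ler_wpM2l//.
    by rewrite ler_wpM2r.
  have nz1 : `|z.1| <= `|z| by rewrite (prod_normE z) le_max lexx.
  have nz2 : `|z.2| <= `|z| by rewrite (prod_normE z) le_max lexx orbT.
  have z2 : `|z| ^+ 2 <= `|z.1| ^+ 2 + `|z.2| ^+ 2.
    by rewrite (prod_normE z); case: (leP `|z.1| `|z.2|) => _; rewrite ?lerDl ?lerDr ?sqr_ge0.
  rewrite mulrAC ler_pdivrMr ?mulr_gt0// (mulrC n).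
  apply: mul_sqr_le; rewrite ?mulr_ge0 ?(ltW Mb1) /n//.
  rewrite -/n (le_trans (ler_wpM2l _ z2)) ?mulr_ge0 ?(ltW cb0)//.
  rewrite (le_trans h)//.
  have n0 : 0 <= n by exact: normr_ge0.
  apply: (@le_trans _ _ ((`|Mb| + 1) * n * (2 * `|z|))).
    rewrite ler_pM ?mulr_ge0 ?addr_ge0//; first by rewrite ler_wpM2r// lerDl.
    lra.
  by rewrite le_eqVlt; apply/orP; left; apply/eqP; ring.
- move=> [f h]; have [u Hu] := e_sol (Q f + y *: h).
  have [v Hv] := e_sol (Q h - y *: f).
  (* The residual [Q p - r *: q - p'] is annihilated by [Q ^ 2 + y ^ 2], hence zero. Allowing [r] to
     be [y] or [- y] covers both components of the system. *)
  have sol r p q p' q' : r ^+ 2 = y ^+ 2 ->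
      Q (Q p) + y ^+ 2 *: p = Q p' + r *: q' ->
      Q (Q q) + y ^+ 2 *: q = Q q' - r *: p' -> Q p - r *: q = p'.
    move=> ry Hp Hq; apply/eqP; rewrite -subr_eq0; apply/eqP; apply: e_inj.
    apply: form_eq => w; rewrite b0 !SB !SZ.
    have := congr1 (b^~ (Q w)) Hp; have := congr1 (b^~ w) Hq.
    rewrite !(bformDl Hb) !(bformZl Hb) !(bformDl Hb) !(bformNl Hb) !(bformZl Hb) -ry.
    rewrite (Q_sym (Q (Q p))) (Q_sym (Q p')) (Q_sym q').
    move=> /eqP; rewrite -subr_eq => /eqP <-.
    move=> /eqP; rewrite -subr_eq => /eqP <-.
    by rewrite (Q_sym p w); ring.
  exists (u, v); congr (_, _); first exact: sol Hu Hv.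
  rewrite /= addrC -[y *: u]opprK -scaleNr.
  by apply: (@sol (- y) v u h f); rewrite ?sqrrN ?scaleNr ?opprK.
Qed.

End form_operator.

(** * Smooth functions and bump functions *)

Section smooth_functions.
Context (R : realType).
Implicit Types (f h : R * R -> R).

(** Coinduction for [smooth]: a class of continuous functions that have partial derivatives and is
    stable under them contains every iterated partial derivative of its members, so no formula for
    these is required. *)
Lemma smooth_coind (C : set (R * R -> R)) :
  (forall f, C f -> continuous f /\
     forall i : 'I_2, (forall x, derivable f x (Defs.basis R i)) /\ C (partial i f)) ->
  forall f, C f -> smooth f.
Proof.
move=> HC f Cf s.
have Cs : C (foldr (@partial R) f s) by elim: s => //= i s /HC[_ /(_ i)[]].
by have [? H] := HC _ Cs; split => // i; exact: (H i).1.
Qed.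

Lemma smooth_partial i f : smooth f -> smooth (partial i f).
Proof. by move=> sf s; have := sf (rcons s i); rewrite foldr_rcons. Qed.

(** Products alone are not stable under [partial]; by the product rule their sums are, which is the
    invariant [smooth_coind] asks for. *)
Inductive product_span : (R * R -> R) -> Prop :=
| product_spanM f h : smooth f -> smooth h -> product_span (fun x => f x * h x)
| product_spanD f h : product_span f -> product_span h ->
    product_span (fun x => f x + h x).

Lemma smoothM f h : smooth f -> smooth h -> smooth (fun x => f x * h x).
Proof.
move=> sf sh; apply: (@smooth_coind product_span); last exact: product_spanM.
move=> F; elim=> {sf sh f h} [f h sf sh|f h _ [cf Hf] _ [ch Hh]].
  split=> [x|i]; first by apply: cvgM; [exact: (sf [::]).1|exact: (sh [::]).1].
  have df x := (sf [::]).2 i x; have dh x := (sh [::]).2 i x.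
  split=> [x|]; first exact: (derivableM (df x) (dh x)).
  have -> : partial i (fun x => f x * h x) =
      (fun x => f x * partial i h x + partial i f x * h x).
    apply/funext => x; rewrite [partial i f x * _]mulrC.
    exact: (deriveM (df x) (dh x)).
  apply: (@product_spanD (fun x => f x * partial i h x) (fun x => partial i f x * h x)).
    by apply: product_spanM; [exact: sf|exact: smooth_partial].
  by apply: product_spanM; [exact: smooth_partial|exact: sh].
split=> [x|i]; first by apply: cvgD; [exact: cf|exact: ch].
have [df Cf] := Hf i; have [dh Ch] := Hh i.
split=> [x|]; first exact: (derivableD (df x) (dh x)).
have -> : partial i (fun x => f x + h x) = (fun x => partial i f x + partial i h x).
  by apply/funext => x; exact: (deriveD (df x) (dh x)).
exact: product_spanD Cf Ch.
Qed.

Lemma derive_scale (f : R -> R) (t a df : R) : is_derive t 1 f df ->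
  derivable f t a /\ 'D_a f t = a * df.
Proof.
move=> [d1 e1]; have dff : differentiable f t by apply/derivable1_diffP.
split; first exact: diff_derivable.
by rewrite deriveE// -[a in 'd f t a]mulr1 [_ * 1]/(a *: (1 : R)) linearZ -deriveE// e1.
Qed.

(** Reduces smoothness in the plane to a class [D] of one-variable functions stable under
    derivation. The chain rule produces a constant factor, which is why the invariant [C] carries
    the scalar [s]. *)
Lemma smooth_ridge (D : set (R -> R)) (p : R -> R) (a b c : R) :
  (forall q, D q -> exists2 q', D q' & forall t : R, is_derive t 1 q (q' t)) ->
  D p -> smooth (fun z : R * R => p (a * z.1 + b * z.2 + c)).
Proof.
move=> HD Dp.
pose C f := exists s q, D q /\ f = fun z => s * q (a * z.1 + b * z.2 + c).
apply: (@smooth_coind C); last first.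
  by exists 1, p; split => //; apply/funext => z; rewrite mul1r.
move=> _ [s [q [Dq ->]]]; have [q' Dq' dq] := HD _ Dq.
pose l (z : R * R) := a * z.1 + b * z.2 + c.
have cl : continuous l.
  move=> z; apply: cvgD; last exact: cvg_cst.
  by apply: cvgD; apply: cvgMl_tmp; [exact: cvg_fst|exact: cvg_snd].
have cq : continuous q.
  by move=> t; apply: differentiable_continuous; apply/derivable1_diffP; case: (dq t).
split=> [z|i].
  apply: cvgMl_tmp; apply: (@continuous_comp _ _ _ l q); [exact: cl|exact: cq].
pose d := a * (Defs.basis R i).1 + b * (Defs.basis R i).2.
(* Along a coordinate direction the argument of [q] moves affinely, so the two difference quotients
   are equal as functions of [h] and no limit has to be compared. *)
have E z : (fun h : R => h^-1 *: (((fun z => q (l z)) \o shift z) (h *: Defs.basis R i) - q (l z)))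
   = (fun h : R => h^-1 *: ((q \o shift (l z)) (h *: d) - q (l z))).
  apply/funext => h /=; congr (_ *: (q _ - _)).
  by rewrite /l /d /= /GRing.scale/=; ring.
have dql z : derivable (fun z => q (l z)) z (Defs.basis R i).
  by rewrite /derivable E; have [] := derive_scale d (dq (l z)).
split=> [z|]; first exact: derivableZ.
exists (s * d), q'; split => //; apply/funext => z.
rewrite /partial -[fun _ => _]/(s *: (fun z => q (l z))) deriveZ//=.
rewrite /derive E -/(derive q (l z) d).
by have [_ ->] := derive_scale d (dq (l z)); rewrite [LHS]mulrA.
Qed.

Lemma smooth_coord (a b c : R) : smooth (fun z : R * R => a * z.1 + b * z.2 + c).
Proof.
pose D : set (R -> R) := [set id; cst 1; cst 0].
apply: (@smooth_ridge D id); last by left; left.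
move=> q [[->|->]|->].
- by exists (cst 1); [left; right|move=> t; exact: is_derive_id].
- by exists (cst 0); [right|move=> t; exact: is_derive_cst].
- by exists (cst 0); [right|move=> t; exact: is_derive_cst].
Qed.

(** [flat 0] is the classical smooth function equal to [exp (-1/t)] for positive [t] and to 0
    elsewhere. Its derivatives are linear combinations of the functions [flat n], so this family is
    tracked instead of [flat 0] alone. *)
Definition flat (n : nat) (t : R) := if 0 < t then t ^- n * expR (- t^-1) else 0.

Lemma flat_le n t : `|flat n t| <= n.+1`!%:R * `|t|.
Proof.
rewrite /flat; case: ifPn => t0; last by rewrite normr0 mulr_ge0.
have s0 : 0 < t^-1 by rewrite invr_gt0.
rewrite !gtr0_norm// ?mulr_gt0 ?expR_gt0 ?exprn_gt0//; last by rewrite -exprVn exprn_gt0.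
have -> : t ^- n = t^-1 ^+ n.+1 * t by rewrite exprSr -mulrA mulVf ?gt_eqF// mulr1 exprVn.
rewrite expRN ler_pdivrMr ?expR_gt0// [leRHS]mulrAC ler_pM2r//.
rewrite mulrC -ler_pdivrMr ?ltr0n ?fact_gt0//.
by apply: le_trans (expR_ge1Dxn n (ltW s0)); rewrite lerDr.
Qed.

Let flat_pos_is_derive n (t : R) : 0 < t ->
  is_derive t 1 (fun t => t ^- n * expR (- t^-1))
    (t ^- n.+2 * expR (- t^-1) - n%:R * (t ^- n.+1 * expR (- t^-1))).
Proof.
move=> t0; have tn0 : t != 0 by rewrite gt_eqF.
pose G s := s ^+ n * expR (- s) : R.
have dG (s : R) : is_derive s 1 G (n%:R * s ^+ n.-1 * expR (- s) - s ^+ n * expR (- s)).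
  have -> : G = (@id R) ^+ n * (expR \o -%R).
    by apply/funext => x; rewrite /G !fctE.
  apply: is_derive_eq.
  by rewrite !fctE /GRing.scale/= -[n%:R]mulr1; ring.
have -> : (fun t => t ^- n * expR (- t^-1)) = G \o (fun t => t^-1).
  by apply/funext => x; rewrite /G /= exprVn.
apply: (@is_derive_eq _ _ _ _ _ _ _ _ (is_derive1_comp (dG t^-1)
  (is_deriveV tn0 (is_derive_id t 1)))).
rewrite /GRing.scale/= -!exprVn; case: n {G dG} => [|n] /=; rewrite ?expr0 ?exprS; ring.
Qed.

Lemma flat_is_derive n (t : R) : is_derive t 1 (flat n) (flat n.+2 t - n%:R * flat n.+1 t).
Proof.
have [t0|t0|->] := ltgtP t 0.
- have -> : flat n.+2 t - n%:R * flat n.+1 t = 0.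
    by rewrite /flat ltNge ltW// mulr0 subr0.
  apply: (@near_eq_is_derive _ _ _ (cst 0)).
  by near=> x; rewrite /flat ltNge ltW//; near: x; exact: lt_nbhsl.
- apply: (@near_eq_is_derive R R^o R^o (fun t : R => t ^- n * expR (- t^-1))).
    by near=> x; rewrite /flat ifT//; near: x; exact: lt_nbhsr.
  by rewrite /flat t0; exact: flat_pos_is_derive.
- have -> : flat n.+2 0 - n%:R * flat n.+1 0 = 0 by rewrite /flat ltxx mulr0 subr0.
  suff H : (fun h : R => h^-1 *: ((flat n \o shift 0) (h *: 1) - flat n 0)) @ 0^' --> (0 : R).
    by split; [apply: cvgP H|apply: cvg_lim H].
  (* At the origin the difference quotient of [flat n] is [flat n.+1] itself, which tends to 0 by
     [flat_le]. *)
  have -> : (fun h : R => h^-1 *: ((flat n \o shift 0) (h *: 1) - flat n 0)) = flat n.+1.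
    apply/funext => h /=; rewrite /GRing.scale/= mulr1 addr0 /flat ltxx subr0.
    by case: ifP => _; rewrite ?mulr0// mulrA -!exprVn exprS.
  apply: (cvg_trans (cvg_app (flat n.+1) (cvg_within (fun y : R => y != 0)))).
  apply/cvgrPdist_le => /= e e0.
  have d0 : 0 < e / (n.+2`!%:R : R) by rewrite divr_gt0// ltr0n fact_gt0.
  have : \forall h \near (0 : R), `|h| <= e / n.+2`!%:R.
    exists (e / n.+2`!%:R) => //= h; rewrite /= sub0r normrN; exact: ltW.
  apply: filterS => h hd; rewrite sub0r normrN (le_trans (flat_le _ _))//.
  by rewrite mulrC -ler_pdivlMr// ltr0n fact_gt0.
Unshelve. all: by end_near. Qed.

Inductive flat_span : (R -> R) -> Prop :=
| flat_gen n : flat_span (flat n)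
| flat_lin a p q : flat_span p -> flat_span q -> flat_span (a *: p + q).

Lemma smooth_flat (a b c : R) : smooth (fun z : R * R => flat 0 (a * z.1 + b * z.2 + c)).
Proof.
apply: (@smooth_ridge flat_span); last exact: flat_gen.
move=> q; elim=> [n|s p1 p2 _ [q1 Dq1 dq1] _ [q2 Dq2 dq2]].
  exists (- n%:R *: flat n.+1 + flat n.+2).
    by apply: flat_lin; exact: flat_gen.
  move=> t; apply: (is_derive_eq (flat_is_derive n t)).
  by rewrite !fctE/= scaleNr addrC.
exists (s *: q1 + q2); first exact: flat_lin.
by move=> t; apply: is_deriveD.
Qed.

Definition bump (a b c d : R) (z : R * R) : R :=
  flat 0 (z.1 - a) * flat 0 (b - z.1) * (flat 0 (z.2 - c) * flat 0 (d - z.2)).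

Lemma flat_ge0 t : 0 <= flat 0 t.
Proof. by rewrite /flat; case: ifP; rewrite // expr0 invr1 mul1r expR_ge0. Qed.

Lemma flat_gt0 t : (0 < flat 0 t) = (0 < t).
Proof. by rewrite /flat; case: ifP; rewrite ?ltxx// expr0 invr1 mul1r expR_gt0. Qed.

Lemma bump_ge0 a b c d z : 0 <= bump a b c d z.
Proof. by rewrite !mulr_ge0// flat_ge0. Qed.

Lemma bump_gt0 a b c d z :
  (0 < bump a b c d z) = (a < z.1 < b) && (c < z.2 < d).
Proof.
have P (x y : R) : 0 <= x -> 0 <= y -> (0 < x * y) = (0 < x) && (0 < y).
  by move=> x0 y0; rewrite !lt0r mulf_eq0 negb_or mulr_ge0// x0 y0 !andbT.
by rewrite /bump !P ?mulr_ge0 ?flat_ge0// !flat_gt0 !subr_gt0.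
Qed.

Lemma smooth_bump a b c d : smooth (bump a b c d).
Proof.
pose F (r s t : R) (z : R * R) := flat 0 (r * z.1 + s * z.2 + t).
have -> : bump a b c d = (fun z => (F 1 0 (- a) z * F (-1) 0 b z) *
    (F 0 1 (- c) z * F 0 (-1) d z)).
  apply/funext => z; rewrite /bump /F !mul0r !addr0 !add0r !mul1r !mulN1r.
  by rewrite (addrC b) (addrC d).
have sF r s t : smooth (F r s t) by exact: smooth_flat.
exact: (smoothM (smoothM (sF _ _ _) (sF _ _ _)) (smoothM (sF _ _ _) (sF _ _ _))).
Qed.

Lemma bump_support a b c d :
  tsupport (bump a b c d) `<=` `[a, b]%classic `*` `[c, d]%classic.
Proof.
have clK : closed (`[a, b]%classic `*` `[c, d]%classic : set (R * R)).
  apply: compact_closed; first exact: norm_hausdorff.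
  by apply: compact_setX; exact: segment_compact.
rewrite /tsupport ((closure_id _).1 clK); apply: closureS => z /=.
move=> bz; have : 0 < bump a b c d z by rewrite lt0r bz bump_ge0.
rewrite bump_gt0 => /andP[/andP[h1 h2] /andP[h3 h4]].
by split; rewrite /= in_itv/=; apply/andP; split; exact: ltW.
Qed.

Lemma bump_test_function (Omega : set (R * R)) a b c d :
  `[a, b]%classic `*` `[c, d]%classic `<=` Omega ->
  test_function Omega (bump a b c d).
Proof.
move=> sub; split; first exact: smooth_bump.
- apply: subclosed_compact (@bump_support a b c d); first exact: closed_closure.
  by apply: compact_setX; exact: segment_compact.
- exact: subset_trans (@bump_support a b c d) sub.
Qed.

End smooth_functions.

(** * Integration by parts *)

Section integration_by_parts.
Context (R : realType).

Lemma integral_derive_eq0 (q q' : R -> R) (M : R) :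
  (forall t : R, is_derive t 1 q (q' t)) -> continuous q' ->
  (forall t, M < `|t| -> q t = 0 /\ q' t = 0) ->
  (\int[lebesgue_measure]_(t in [set: measurableTypeR R]) (q' t)%:E = 0)%E.
Proof.
move=> dq cq' q0; pose N := `|M| + 1.
have N0 : 0 < N by rewrite ltr_wpDl.
have MN : M < N by rewrite (le_lt_trans (ler_norm M))// ltrDl.
have cq : continuous q.
  by move=> t; apply: differentiable_continuous; apply/derivable1_diffP; case: (dq t).
have -> : (\int[lebesgue_measure]_(t in [set: measurableTypeR R]) (q' t)%:E =
    \int[lebesgue_measure]_(t in `[(- N)%R, N]%classic) (q' t)%:E)%E.
  rewrite [RHS]integral_mkcond; apply: eq_integral => t _; rewrite patchE.
  case: ifPn => //; rewrite notin_setE/= in_itv/= -ler_norml => /negP; rewrite -ltNge => Nt.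
  by rewrite (q0 t (lt_trans MN Nt)).2.
have NN : - N < N by rewrite gtrN.
have dF : derivable_oo_LRcontinuous q (- N) N.
  split; first by move=> t _; case: (dq t).
    by apply: cvg_at_right_filter; exact: cq.
  by apply: cvg_at_left_filter; exact: cq.
have F'f : {in `]- N, N[, derive1 q =1 q'}.
  by move=> t _; rewrite derive1E; case: (dq t).
rewrite (continuous_FTC2 NN _ dF F'f); last exact: continuous_subspaceT.
have [|-> _] := q0 N; first by rewrite gtr0_norm.
have [|-> _] := q0 (- N); first by rewrite normrN gtr0_norm.
by rewrite subee.
Qed.

Lemma compact_support_integrable (f : R * R -> R) (K : set (R * R)) :
  continuous f -> compact K -> (forall x, ~ K x -> f x = 0) ->
  lebesgue2.-integrable [set: mplane R] (EFin \o f).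
Proof.
move=> cf cK fK.
have mf := continuous_measurable_fun2 cf.
have [M fM] := continuous_compact_support_bounded cf cK fK.
have mK : measurable (K : set (mplane R)).
  apply: closed_measurable2; apply: compact_closed cK.
  exact: norm_hausdorff.
have Kfin : (lebesgue2 K < +oo)%E.
  by apply: bounded_lebesgue2_lty => //; exact: compact_bounded.
have I1 : lebesgue2.-integrable K (EFin \o f).
  apply: measurable_bounded_integrable => //; first exact: measurable_funS mf.
  exists M; split; first exact: num_real.
  by move=> r Mr x Kx /=; rewrite (le_trans (fM x))// ltW.
have /integrable_mkcond/= := I1 => /(_ mK).
apply: eq_integrable => // x _; rewrite patchE; case: ifPn => //.
by move=> /negP; rewrite inE => /fK /= ->.
Qed.

Lemma partial_support (phi : R * R -> R) i x : ~ tsupport phi x -> partial i phi x = 0.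
Proof.
move=> xK; rewrite /partial -(derive_cst (0 : R) x (Defs.basis R i)).
apply: near_eq_derive.
have : nbhs x (~` tsupport phi).
  by apply: open_nbhs_nbhs; split => //; apply: closed_openC; exact: closed_closure.
apply: filterS => y yK; apply/eqP; apply: contra_notT yK => phiy.
by apply: subset_closure.
Qed.

Lemma support_eq0 (phi : R * R -> R) x : ~ tsupport phi x -> phi x = 0.
Proof. by apply: contra_notP => /eqP phix; apply: subset_closure. Qed.

(** By Fubini the integral is taken first along the direction of differentiation; on each line it is
    the integral of the derivative of a compactly supported function. The two cases for [i] differ
    only in the order of integration. *)
Lemma integral_partial_eq0 (Omega : open_set R) (phi : R * R -> R) i :
  test_function Omega phi -> \int[lebesgue2]_(x in Omega) partial i phi x = 0.
Proof.
move=> [sphi cphi sub].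
have Iphi : lebesgue2.-integrable [set: mplane R] (EFin \o partial i phi).
  by apply: compact_support_integrable cphi _; [exact: (sphi [:: i]).1|exact: partial_support].
have [M [_ HM]] := compact_bounded cphi.
have out x : M + 1 < `|x| -> phi x = 0 /\ partial i phi x = 0.
  move=> Mx; have xS : ~ tsupport phi x.
    have M1 : M < M + 1 by rewrite ltrDl.
    by move=> xS; have /= := HM _ M1 _ xS; rewrite leNgt Mx.
  by split; [exact: support_eq0|exact: partial_support].
have line (z : R * R) (t : R) (l : R -> R * R) :
    (forall s, l s = z + s *: Defs.basis R i) ->
    is_derive t 1 (phi \o l) (partial i phi (l t)) /\
    {for t, continuous (partial i phi \o l)}.
  move=> lE; split; last first.
    apply: (@continuous_comp _ _ _ l); last exact: (sphi [:: i]).1.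
    have -> : l = (fun s => z + s *: Defs.basis R i) by apply/funext.
    by apply: cvgD; [exact: cvg_cst|apply: cvgZr_tmp; exact: cvg_id].
  have E : (fun h : R => h^-1 *: (((phi \o l) \o shift t) (h *: 1) - (phi \o l) t))
     = (fun h : R => h^-1 *: ((phi \o shift (l t)) (h *: Defs.basis R i) - phi (l t))).
    apply/funext => h /=; congr (_ *: (phi _ - _)).
    by rewrite !lE [h *: 1]mulr1 scalerDl addrCA.
  have d := (sphi [::]).2 i (l t).
  by split; [rewrite /derivable E|rewrite /derive E].
rewrite /Rintegral integral_mkcond.
rewrite (_ : integral _ _ _ = 0%E)//.
under eq_integral => x _.
  rewrite (_ : _ x = (partial i phi x)%:E); last first.
    rewrite patchE; case: ifPn => //; rewrite notin_setE => xO.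
    by rewrite partial_support// => /sub.
  over.
case: (unliftP ord0 i) => [j|] ij; last first.
  rewrite -(integral21_prod_meas1 Iphi); apply: integral0_eq => y _ /=.
  have ly (t : R) : is_derive t 1 (phi \o (fun t => (t, y))) (partial i phi (t, y)) /\
      {for t, continuous (partial i phi \o (fun t => (t, y)))}.
    apply: (line (0, y)) => s.
    by rewrite /Defs.basis ij eqxx; congr (_, _); rewrite /= /GRing.scale/= ?mulr1 ?mulr0 ?add0r ?addr0.
  apply: (@integral_derive_eq0 (phi \o (fun t => (t, y))) _ (M + 1)).
  - by move=> t; exact: (ly t).1.
  - by move=> t; exact: (ly t).2.
  - by move=> t Mt; apply: out; rewrite (lt_le_trans Mt)// prod_normE/= le_max lexx.
rewrite -(integral12_prod_meas1 Iphi); apply: integral0_eq => x _ /=.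
have lx (t : R) : is_derive t 1 (phi \o (fun t => (x, t))) (partial i phi (x, t)) /\
    {for t, continuous (partial i phi \o (fun t => (x, t)))}.
  apply: (line (x, 0)) => s.
  by rewrite /Defs.basis ij/=; congr (_, _); rewrite /= /GRing.scale/= ?mulr1 ?mulr0 ?add0r ?addr0.
apply: (@integral_derive_eq0 (phi \o (fun t => (x, t))) _ (M + 1)).
- by move=> t; exact: (lx t).1.
- by move=> t; exact: (lx t).2.
- by move=> t Mt; apply: out; rewrite (lt_le_trans Mt)// prod_normE/= le_max lexx orbT.
Qed.

End integration_by_parts.

Section real_integrals.
Context d (T : measurableType d) (R : realType) (mu : {measure set T -> \bar R}).
Implicit Types (D : set T) (f h : T -> R).

Lemma integrable_funD D f h : measurable D ->
  mu.-integrable D (EFin \o f) -> mu.-integrable D (EFin \o h) ->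
  mu.-integrable D (EFin \o (fun x => f x + h x)).
Proof. by move=> mD If Ih; exact: (integrableD mD If Ih). Qed.

Lemma integrable_funZ D a f : measurable D ->
  mu.-integrable D (EFin \o f) -> mu.-integrable D (EFin \o (fun x => a * f x)).
Proof. by move=> mD If; exact: (integrableZl mD a If). Qed.

Lemma le_Rintegral D f h : measurable D ->
  mu.-integrable D (EFin \o f) -> mu.-integrable D (EFin \o h) ->
  (forall x, D x -> f x <= h x) ->
  \int[mu]_(x in D) f x <= \int[mu]_(x in D) h x.
Proof.
move=> mD If Ih fh; rewrite -subr_ge0 -RintegralB//.
by apply: Rintegral_ge0 => x Dx; rewrite subr_ge0 fh.
Qed.

End real_integrals.

(** * Test functions as elements of H1, and their Poincare inequality *)

Section test_functions_H1.
Context (R : realType) (Omega : open_set R).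

Let mOmega : measurable (Omega : set (mplane R)).
Proof. by apply: open_measurable2; exact: oset_open. Qed.

Lemma test_functionM (f phi : R * R -> R) : smooth f -> test_function Omega phi ->
  test_function Omega (fun x => f x * phi x).
Proof.
move=> sf [sphi cphi sub].
have ts : tsupport (fun x => f x * phi x) `<=` tsupport phi.
  by apply: closureS => x /=; rewrite mulf_eq0 negb_or => /andP[].
split; first exact: smoothM.
- by apply: subclosed_compact cphi ts; exact: closed_closure.
- exact: subset_trans sub.
Qed.

Lemma partialM (f h : R * R -> R) i x : smooth f -> smooth h ->
  partial i (fun x => f x * h x) x = f x * partial i h x + partial i f x * h x.
Proof.
move=> sf sh; rewrite [partial i f x * _]mulrC.
exact: (deriveM ((sf [::]).2 i x) ((sh [::]).2 i x)).
Qed.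

(** By the product rule, moving both integrals to one side gives the integral of [partial i] of the
    test function [phi psi], which is zero. *)
Lemma test_function_weak_partial i (phi : R * R -> R) : test_function Omega phi ->
  weak_partial Omega i phi (partial i phi).
Proof.
move=> tphi psi tpsi; have [sphi _ _] := tphi; have [spsi _ _] := tpsi.
have L1 := test_function_L2 tphi; have L2 := test_function_L2 tpsi.
have L3 := partial_test_function_L2 i tphi.
have L4 := partial_test_function_L2 i tpsi.
apply/eqP; rewrite -addr_eq0 -RintegralD//; try exact: L2_mul_integrable.
apply/eqP; rewrite -[RHS](integral_partial_eq0 i (test_functionM sphi tpsi)).
by apply: eq_Rintegral => x _; rewrite partialM.
Qed.

Lemma test_function_is_H1 phi : test_function Omega phi ->
  is_H1 Omega (phi, fun i => partial i phi).
Proof.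
move=> tphi; split; first exact: test_function_L2.
- by move=> i; exact: partial_test_function_L2.
- by move=> i; exact: test_function_weak_partial.
Qed.

(* Apply the definition of the weak derivative [grad u ord0] to the test function
   [l * fn u], where [l] is the first coordinate. *)
Lemma test_function_poincare (N : R) (u : H1_fun Omega) :
  0 <= N -> (forall x, oset Omega x -> `|x.1| <= N) ->
  test_function Omega (fn u) -> (forall i, grad u i = partial i (fn u)) ->
  \int[lebesgue2]_(x in Omega) (fn u x * fn u x) <=
  4 * N ^+ 2 * \int[lebesgue2]_(x in Omega) (grad u ord0 x * grad u ord0 x).
Proof.
move=> N0 HN tu gu; have [su _ _] := tu.
have [L0 L1 wu] : is_H1 Omega u by have := valP u; rewrite inE.
pose l (x : R * R) := 1 * x.1 + 0 * x.2 + 0 : R.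
have sl : smooth l by exact: smooth_coord.
have tlu : test_function Omega (fun x => l x * fn u x) by exact: test_functionM.
have dl x : partial ord0 l x = 1.
  rewrite /partial /derive (_ : (fun _ => _) = (fun h => h^-1 * h)).
    apply: lim_near_cst => //; near=> h; rewrite mulVf//.
    by near: h; exact: nbhs_dnbhs_neq.
  apply/funext => h; rewrite /l /Defs.basis eqxx /GRing.scale/=; congr (_ * _).
  by rewrite /GRing.scale/=; ring.
have := wu ord0 _ tlu.
have -> : \int[lebesgue2]_(x in Omega) (fn u x * partial ord0 (fun x => l x * fn u x) x) =
    \int[lebesgue2]_(x in Omega) (fn u x * (l x * grad u ord0 x) + fn u x * fn u x).
  apply: eq_Rintegral => x _.
  by rewrite partialM// dl mul1r -gu mulrDr.
have Lf : L2 Omega (fun x => l x * fn u x) by exact: test_function_L2.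
have Lg : L2 Omega (fun x => l x * grad u ord0 x).
  have -> : (fun x => l x * grad u ord0 x) =
      (fun x => partial ord0 (fun x => l x * fn u x) x + -1 * fn u x).
    by apply/funext => x; rewrite partialM// dl -gu; ring.
  by apply: L2D; [exact: partial_test_function_L2|exact: L2Z].
have I1 := L2_mul_integrable L0 Lg; have I2 := L2_mul_integrable L0 L0.
have I3 := L2_mul_integrable (L1 ord0) Lf.
have I4 := L2_mul_integrable (L1 ord0) (L1 ord0).
rewrite RintegralD//.
have -> : \int[lebesgue2]_(x in Omega) (fn u x * (l x * grad u ord0 x)) =
    \int[lebesgue2]_(x in Omega) (grad u ord0 x * (l x * fn u x)).
  by apply: eq_Rintegral => x _; ring.
set J := \int[lebesgue2]_(x in Omega) (grad u ord0 x * (l x * fn u x)).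
set F := \int[lebesgue2]_(x in Omega) (fn u x * fn u x).
set G := \int[lebesgue2]_(x in Omega) (grad u ord0 x * grad u ord0 x).
move=> JF.
(* The identity [JF] says [F = - 2 J]. Young's inequality is weighted so that half of [F] can be
   absorbed on the left, which produces the factor [4 * N ^+ 2]. *)
have : - 2 * J <= 2^-1 * F + 2 * N ^+ 2 * G.
  rewrite -!RintegralZl// -RintegralD//; try exact: integrable_funZ.
  apply: le_Rintegral => //; first exact: integrable_funZ.
    by apply: integrable_funD => //; exact: integrable_funZ.
  move=> x Ox; have := HN x Ox.
  rewrite /l mul1r mul0r !addr0 => xN.
  have x2 : x.1 ^+ 2 <= N ^+ 2.
    by rewrite -(real_normK (num_real x.1)) ler_pXn2r// nnegrE.
  have h1 := sqr_ge0 (fn u x + 2 * x.1 * grad u ord0 x).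
  have h2 : x.1 ^+ 2 * grad u ord0 x ^+ 2 <= N ^+ 2 * grad u ord0 x ^+ 2.
    by rewrite ler_wpM2r ?sqr_ge0.
  nra.
lra.
Unshelve. all: by end_near. Qed.

End test_functions_H1.

(** * Weighted Dirichlet forms on H10 *)

Section semi_inner_theory.
Context (R : realType) (V : lmodType R) (B : semi_inner V).

Lemma sipnorm_sqr x : sipnorm B x ^+ 2 = B x x.
Proof. by rewrite sqr_sqrtr// sip_ge0. Qed.

(* Polarisation, then the discriminant in [t] of the resulting bound for [t u], [v]. *)
Lemma semi_inner_bound (b : V -> V -> R) (M : R) : 0 <= M ->
  (forall u v, b u v = b v u) ->
  (forall u v w, b (u + v) w = b u w + b v w) ->
  (forall a u v, b (a *: u) v = a * b u v) ->
  (forall w, `|b w w| <= M * B w w) ->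
  forall u v, `|b u v| <= M * (sipnorm B u * sipnorm B v).
Proof.
move=> M0 bC bD bZ bM u v.
have BD x y z : B z (x + y) = B z x + B z y by rewrite sipC sipDl !(sipC _ z).
have BZ r x y : B x (r *: y) = r * B x y by rewrite sipC sipZl sipC.
have bDr x y z : b z (x + y) = b z x + b z y by rewrite bC bD !(bC z).
have bZr r x y : b x (r *: y) = r * b x y by rewrite bC bZ bC.
have : b u v ^+ 2 <= (M * B v v) * (M * B u u).
  apply: discriminant_le => [|t]; first by rewrite mulr_ge0 ?sip_ge0.
  have := bM (t *: u + v); have := bM (t *: u - v).
  rewrite -scaleN1r !(bD, bDr, bZ, bZr) !(sipDl, BD, sipZl, BZ) (bC v u) (sipC B v u).
  by move=> /ler_normlP[h1 h2] /ler_normlP[h3 h4]; nra.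
rewrite (_ : _ * _ = (M * (sipnorm B u * sipnorm B v)) ^+ 2); last first.
  by rewrite !exprMn !sipnorm_sqr; ring.
by rewrite -(real_normK (num_real (b u v))) ler_pXn2r// nnegrE ?mulr_ge0 ?sqrtr_ge0.
Qed.

End semi_inner_theory.

Section gradient_forms.
Context (R : realType) (Omega : open_set R).
Implicit Types (u v w : H1_fun Omega) (k : R * R -> R).

Let mOmega : measurable (Omega : set (mplane R)).
Proof. by apply: open_measurable2; exact: oset_open. Qed.

Lemma H1_fun_is_H1 u : is_H1 Omega u.
Proof. by have := valP u; rewrite inE. Qed.

(** Measurability instead of continuity admits weights cut off by the indicator of a box, as the
    approximate eigenfunctions require. *)
Definition bounded_weight k (M : R) :=
  [/\ 0 <= M, measurable_fun (Omega : set (mplane R)) k &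
      forall x, oset Omega x -> `|k x| <= M].

Definition gradient_form k u v : R := \int[lebesgue2]_(x in Omega)
  (k x * \sum_i grad u i x * grad v i x).

Lemma grad_dot_integrable u v : lebesgue2.-integrable Omega
  (EFin \o (fun x => \sum_i grad u i x * grad v i x)).
Proof.
have [_ u1 _] := H1_fun_is_H1 u; have [_ v1 _] := H1_fun_is_H1 v.
rewrite (_ : EFin \o _ =
   (fun x => \sum_i (EFin \o (fun x => (grad u i x * grad v i x)%R)) x)%E).
  by apply: integrable_sum => // i _; exact: L2_mul_integrable.
by apply/funext => x /=; rewrite sumEFin.
Qed.

Lemma gradient_form_integrable k M u v : bounded_weight k M ->
  lebesgue2.-integrable Omega
    (EFin \o (fun x => k x * \sum_i grad u i x * grad v i x)).
Proof.
move=> [M0 mk kM]; have I := grad_dot_integrable u v.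
apply: (le_integrable mOmega _ _ (integrable_funZ M mOmega I)).
  apply/measurable_EFinP; apply: measurable_funM => //.
  by apply/measurable_EFinP; exact: measurable_int I.
move=> x Ox /=; rewrite lee_fin !normrM ler_wpM2r//.
by rewrite (le_trans (kM x Ox))// ler_norm.
Qed.

Lemma gradient_formC k u v : gradient_form k u v = gradient_form k v u.
Proof.
by apply: eq_Rintegral => x _; congr (_ * _); apply: eq_bigr => i _; rewrite mulrC.
Qed.

Lemma gradient_formDl k M u v w : bounded_weight k M ->
  gradient_form k (u + v) w = gradient_form k u w + gradient_form k v w.
Proof.
move=> kM; rewrite /gradient_form -RintegralD//; try exact: gradient_form_integrable kM.
apply: eq_Rintegral => x _ /=; rewrite -mulrDr -big_split/=.
by congr (_ * _); apply: eq_bigr => i _; rewrite -mulrDl.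
Qed.

Lemma gradient_formZl k M a u v : bounded_weight k M ->
  gradient_form k (a *: u) v = a * gradient_form k u v.
Proof.
move=> kM; rewrite /gradient_form -RintegralZl//; try exact: gradient_form_integrable kM.
apply: eq_Rintegral => x _ /=; rewrite mulrCA; congr (_ * _).
by rewrite mulr_sumr; apply: eq_bigr => i _; rewrite mulrA.
Qed.

Lemma grad_dot_ge0 u x : 0 <= \sum_i grad u i x * grad u i x.
Proof. by apply: sumr_ge0 => i _; exact: sqr_ge0. Qed.

Lemma gradient_form_bound k M u v : bounded_weight k M ->
  `|gradient_form k u v| <=
  M * (sipnorm (H1_semi_inner Omega) u * sipnorm (H1_semi_inner Omega) v).
Proof.
move=> kM; have [M0 mk kM'] := kM.
apply: semi_inner_bound => //.
- exact: gradient_formC.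
- by move=> *; exact: gradient_formDl kM.
- by move=> *; exact: gradient_formZl kM.
move=> w; have I := gradient_form_integrable w w kM.
rewrite (le_trans (le_normr_Rintegral mOmega I))//.
rewrite -[H1_semi_inner Omega w w]/(H1_inner w w) -RintegralZl//; last first.
  exact: H1_inner_integrable.
apply: le_Rintegral => //.
- rewrite (_ : EFin \o _ = (abse \o (EFin \o (fun x => k x * \sum_i grad w i x * grad w i x))))//.
  exact: integrable_abse.
- by apply: integrable_funZ => //; exact: H1_inner_integrable.
move=> x Ox; rewrite normrM (ger0_norm (grad_dot_ge0 w x)).
by rewrite ler_pM ?grad_dot_ge0 ?kM'// ler_wpDl// sqr_ge0.
Qed.

Lemma bounded_weight1 : bounded_weight (cst 1) 1.
Proof. by split => // x _; rewrite normr1. Qed.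

Lemma gradient_form_ge k M c u : bounded_weight k M ->
  (forall x, oset Omega x -> c <= k x) ->
  c * gradient_form (cst 1) u u <= gradient_form k u u.
Proof.
move=> kM ck; rewrite /gradient_form -RintegralZl//; last first.
  exact: gradient_form_integrable bounded_weight1.
apply: le_Rintegral => //.
- by apply: integrable_funZ => //; exact: gradient_form_integrable bounded_weight1.
- exact: gradient_form_integrable kM.
by move=> x Ox; rewrite mul1r ler_wpM2r ?grad_dot_ge0 ?ck.
Qed.

Lemma gradient_form_ge0 u : 0 <= gradient_form (cst 1) u u.
Proof.
by apply: Rintegral_ge0 => x _; rewrite mul1r grad_dot_ge0.
Qed.

(** Packaged as a [semi_inner] to obtain the triangle inequality for the gradient seminorm, which
    the density argument in [H10_poincare] uses. *)
Definition dirichlet : semi_inner (H1_fun Omega) := SemiInner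
  (gradient_formC (cst 1)) (fun u v w => gradient_formDl u v w bounded_weight1)
  (fun a u v => gradient_formZl a u v bounded_weight1) gradient_form_ge0.

Lemma dirichlet_le u : sipnorm dirichlet u <= sipnorm (H1_semi_inner Omega) u.
Proof.
rewrite ler_sqrt ?sip_ge0//; apply: le_Rintegral => //.
- exact: gradient_form_integrable bounded_weight1.
- exact: H1_inner_integrable.
by move=> x Ox; rewrite mul1r ler_wpDl// sqr_ge0.
Qed.

Definition H1_class (u : H1_fun Omega) : H1 Omega :=
  \pi_(sip_quot (H1_semi_inner Omega))%qT u.

Local Notation q := H1_class.

Lemma H1_classD u v : q (u + v) = q u + q v.
Proof. exact: sip_piD. Qed.

Lemma H1_classZ a u : q (a *: u) = a *: q u.
Proof. exact: sip_piZ. Qed.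

Lemma H1_classK (u : H1 Omega) : q (repr u) = u.
Proof. exact: reprK. Qed.

Lemma H1_classB u v : q (u - v) = q u - q v.
Proof. by rewrite -scaleN1r H1_classD H1_classZ scaleN1r. Qed.

Lemma H1_pi_norm u : `|q u| = sipnorm (H1_semi_inner Omega) u.
Proof. exact: sip_pi_nrm. Qed.

(** The form does not see functions of zero H1 seminorm; hence [weighted_laplacian], although
    computed on chosen representatives, depends on the classes only. *)
Lemma gradient_form_eq0 k M u v : bounded_weight k M ->
  sipnorm (H1_semi_inner Omega) u = 0 -> gradient_form k u v = 0.
Proof.
move=> kM u0; apply/eqP; rewrite -normr_le0.
by rewrite (le_trans (gradient_form_bound u v kM))// u0 mul0r mulr0.
Qed.

Lemma gradient_form_eq k M u u' v : bounded_weight k M ->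
  sipnorm (H1_semi_inner Omega) (u - u') = 0 ->
  gradient_form k u v = gradient_form k u' v.
Proof.
move=> kM uu'; rewrite -[u](subrK u') (gradient_formDl _ _ _ kM).
by rewrite (gradient_form_eq0 _ kM)// add0r.
Qed.

Let rp (u : H10 Omega) : H1_fun Omega := repr (H10_val u).

Lemma weighted_laplacianE k (u v : H10 Omega) :
  weighted_laplacian k u v = gradient_form k (rp u) (rp v).
Proof. by []. Qed.

Lemma repr_pi_eq u : sipnorm (H1_semi_inner Omega) (repr (q u) - u) = 0.
Proof. exact: sip_quot_repr. Qed.

Lemma weighted_laplacian_form k M : bounded_weight k M ->
  bounded_form (weighted_laplacian k : H10 Omega -> H10 Omega -> R) M.
Proof.
move=> kM; split.
- by move=> u v; exact: gradient_formC.
- move=> u v w; rewrite !weighted_laplacianE -(gradient_formDl _ _ _ kM).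
  apply: (gradient_form_eq _ kM); rewrite -(repr_pi_eq (rp u + rp v)).
  by congr (sipnorm _ (repr _ - _)).
- move=> a u v; rewrite !weighted_laplacianE -(gradient_formZl _ _ _ kM).
  apply: (gradient_form_eq _ kM); rewrite -(repr_pi_eq (a *: rp u)).
  by congr (sipnorm _ (repr _ - _)).
- by move=> u v; exact: gradient_form_bound.
Qed.

Lemma gradient_form_class k M u v : bounded_weight k M ->
  gradient_form k (repr (q u)) v = gradient_form k u v.
Proof. by move=> kM; apply: (gradient_form_eq _ kM); exact: repr_pi_eq. Qed.

(** The squared H1 norm is at most [4 N^2 + 1] times the Dirichlet energy, and
    [4 N^2 + 1 <= (2 N + 1)^2]. *)
Lemma H1_test_poincare (N : R) u : 0 <= N ->
  (forall x, oset Omega x -> `|x.1| <= N) ->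
  test_function Omega (fn u) -> (forall i, grad u i = partial i (fn u)) ->
  sipnorm (H1_semi_inner Omega) u <= (2 * N + 1) * sipnorm dirichlet u.
Proof.
move=> N0 HN tu gu; have := test_function_poincare N0 HN tu gu.
have [u0 u1 _] := H1_fun_is_H1 u.
have I1 := L2_mul_integrable u0 u0; have I2 := grad_dot_integrable u u.
have I3 := L2_mul_integrable (u1 ord0) (u1 ord0).
have DE : dirichlet u u = \int[lebesgue2]_(x in Omega) (\sum_i grad u i x * grad u i x).
  by apply: eq_Rintegral => x _; rewrite mul1r.
have : \int[lebesgue2]_(x in Omega) (grad u ord0 x * grad u ord0 x) <= dirichlet u u.
  rewrite DE; apply: le_Rintegral => // x Ox.
  by rewrite big_ord_recl lerDl; apply: sumr_ge0 => i _; exact: sqr_ge0.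
have HE : H1_semi_inner Omega u u =
    \int[lebesgue2]_(x in Omega) (fn u x * fn u x) + dirichlet u u.
  by rewrite DE -RintegralD.
have := sip_ge0 dirichlet u.
move: (\int[lebesgue2]_(x in Omega) (grad u ord0 x * grad u ord0 x)) => G.
move: HE; move: (\int[lebesgue2]_(x in Omega) (fn u x * fn u x)) => F HE D0 GD FG.
rewrite -(@ler_pXn2r _ 2)// ?nnegrE ?mulr_ge0 ?sqrtr_ge0 ?addr_ge0 ?mulr_ge0//.
rewrite exprMn !sipnorm_sqr HE.
have : 4 * N ^+ 2 * G <= 4 * N ^+ 2 * dirichlet u u by rewrite ler_wpM2l ?mulr_ge0 ?sqr_ge0.
have : 0 <= N * dirichlet u u by rewrite mulr_ge0.
nra.
Qed.

Lemma H10_poincare (N : R) (w : H10 Omega) : 0 <= N ->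
  (forall x, oset Omega x -> `|x.1| <= N) ->
  `|w| <= (2 * N + 1) * sipnorm dirichlet (repr (H10_val w)).
Proof.
move=> N0 HN; have := valP w; rewrite inE => cw.
apply/ler_addgt0Pr => e e0.
have K0 : 0 <= 2 * N + 1 by rewrite addr_ge0 ?mulr_ge0.
(* Replacing [w] by a nearby test function costs the distance once in the H1 norm and [2 * N + 1]
   times through the gradient seminorm. *)
have d0 : 0 < e / (2 * N + 1 + 1) by rewrite divr_gt0// ltr_wpDl.
have [_ [[u [tu gu] <-] wu]] := cw _ (nbhsx_ballx _ _ d0).
pose v := rp w; pose H := H1_semi_inner Omega.
have {}wu : sipnorm H (v - u) < e / (2 * N + 1 + 1).
  by move: wu; rewrite -ball_normE /= -[val w]H1_classK -/(q u) -H1_classB H1_pi_norm.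
have uv : sipnorm H (u - v) = sipnorm H (v - u).
  by rewrite -opprB -scaleN1r sipnormZ normrN1 mul1r.
rewrite -[leLHS]/(sipnorm H v) -[v in leLHS](subrK u).
rewrite (le_trans (sipnormD _ _ _))//.
have h1 : sipnorm H u <= (2 * N + 1) * (sipnorm dirichlet v + sipnorm H (v - u)).
  rewrite (le_trans (H1_test_poincare N0 HN tu gu))// ler_wpM2l//.
  have := sipnormD dirichlet (u - v) v; rewrite subrK => /le_trans; apply.
  by rewrite addrC lerD2l -uv dirichlet_le.
rewrite (le_trans (lerD (lexx _) h1))// mulrDr addrCA lerD2l -{1}[sipnorm H _]mul1r -mulrDl.
by rewrite addrC -ler_pdivlMl ?ltr_wpDl// mulrC ltW.
Qed.

Lemma weighted_laplacian_coercive k M c (N : R) : 0 < c -> bounded_weight k M ->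
  (forall x, oset Omega x -> c <= k x) ->
  0 <= N -> (forall x, oset Omega x -> `|x.1| <= N) ->
  coercive (weighted_laplacian k : H10 Omega -> H10 Omega -> R)
    (c / (2 * N + 1) ^+ 2).
Proof.
move=> c0 kM ck N0 HN.
have K0 : 0 < 2 * N + 1 by rewrite ltr_wpDl ?mulr_ge0.
split=> [|u]; first by rewrite divr_gt0// exprn_gt0.
rewrite weighted_laplacianE (le_trans _ (gradient_form_ge _ kM ck))//.
rewrite -mulrA ler_pM2l// ler_pdivrMl ?exprn_gt0//.
rewrite -[gradient_form _ _ _]/(dirichlet (rp u) (rp u)) -sipnorm_sqr -exprMn.
by rewrite ler_pXn2r ?nnegrE ?mulr_ge0 ?sqrtr_ge0 ?(ltW K0)// H10_poincare.
Qed.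

End gradient_forms.

(** * Completeness of H10 *)

Section L2_limit.
Context d (T : measurableType d) (R : realType) (mu : {measure set T -> \bar R}).
Context (D : set T) (mD : measurable D) (muD : (mu D < +oo)%E).

Definition square_integrable (f : T -> R) :=
  measurable_fun D f /\ mu.-integrable D (fun x => (f x ^+ 2)%:E).

Lemma square_integrableB f h : square_integrable f -> square_integrable h ->
  square_integrable (fun x => f x - h x).
Proof.
move=> [mf If] [mh Ih]; have mfh : measurable_fun D (fun x => f x - h x).
  exact: measurable_funB.
split => //.
apply: (le_integrable mD _ _ (integrable_funZ 2 mD (integrable_funD mD If Ih))) => /=.
  by apply/measurable_EFinP; exact: measurable_funX.
move=> x _ /=; rewrite lee_fin ger0_norm ?sqr_ge0// ger0_norm; last first.
  by rewrite mulr_ge0 ?addr_ge0 ?sqr_ge0.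
by have := sqr_ge0 (f x + h x); nra.
Qed.

Lemma integral_EFin f : mu.-integrable D (EFin \o f) ->
  (\int[mu]_(x in D) (f x)%:E = (\int[mu]_(x in D) f x)%:E)%E.
Proof. by move=> If; rewrite /Rintegral fineK// integrable_fin_num. Qed.

Lemma limn_einf_le (u : (\bar R)^nat) n c :
  (forall m, (n <= m)%N -> u m <= c)%E -> (limn_einf u <= c)%E.
Proof.
move=> uc; rewrite limn_einf_lim; apply: lime_le; first exact: is_cvg_einfs.
near=> m; apply: ereal_inf_le; exists (u (maxn n m)); last by rewrite uc// leq_maxl.
by exists (maxn n m) => //=; rewrite leq_maxr.
Unshelve. all: by end_near. Qed.

Section rapid.
Context (f : nat -> T -> R) (C : R).
Hypothesis Lf : forall n, square_integrable (f n).
Hypothesis Cf : forall n m, (n <= m)%N ->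
  \int[mu]_(x in D) (f n x - f m x) ^+ 2 <= C / 4 ^+ n.

Let df n x := f n.+1 x - f n x.

Let mdf n : measurable_fun D (df n).
Proof. by apply: measurable_funB; [case: (Lf n.+1)|case: (Lf n)]. Qed.

(** On a set of finite measure, [|x| <= 2 ^- n + 2 ^+ n * x^2] trades the decay [4 ^- n] of the
    squared [L2] distances for a decay [2 ^- n] in [L1]. The constant is shaped for a geometric
    series with terms [K / 2 ^ n.+1]. *)
Let df_L1 n : (\int[mu]_(x in D) `|df n x|%:E <=
  (2 * (fine (mu D) + C) / (2 ^ n.+1)%:R)%:E)%E.
Proof.
have [_ I2] := square_integrableB (Lf n.+1) (Lf n).
have I1 : mu.-integrable D (EFin \o (fun=> 2 ^- n : R)).
  apply/integrableP; split; first exact: measurable_cst.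
  by rewrite integral_cst//= lte_mul_pinfty// lee_fin.
have I3 := integrable_funD mD I1 (integrable_funZ (2 ^+ n) mD I2).
have bd x : `|df n x| <= 2 ^- n + 2 ^+ n * df n x ^+ 2.
  have := sqr_ge0 (2 ^- n - `|df n x|); have p0 : 0 < 2 ^+ n :> R by rewrite exprn_gt0.
  rewrite sqrrB real_normK ?num_real// => h.
  rewrite -(ler_pM2l (_ : 0 < 2 ^- n :> R)) ?invr_gt0// mulrDr mulrA mulVf ?gt_eqF// mul1r.
  have : 0 <= 2 ^- n * `|df n x| by rewrite mulr_ge0// invr_ge0 ltW.
  by move: h; rewrite expr2 -mulr_natl; lra.
have Iabs : mu.-integrable D (EFin \o (fun x => `|df n x|)).
  apply: (le_integrable mD _ _ I3).
    by apply/measurable_EFinP; exact: measurableT_comp (mdf n).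
  by move=> x _ /=; rewrite lee_fin normr_id (le_trans (bd x))// ler_norm.
rewrite integral_EFin// lee_fin (le_trans (le_Rintegral mD Iabs I3 (fun x _ => bd x)))//.
rewrite RintegralD//; last exact: integrable_funZ.
rewrite RintegralZl// Rintegral_cst//.
have := Cf (leqnSn n).
rewrite (@eq_Rintegral _ _ _ _ _ (fun x => df n x ^+ 2)); last first.
  by move=> x _; rewrite -sqrrN opprB.
move=> h; rewrite (@le_trans _ _ (2 ^- n * fine (mu D) + 2 ^+ n * (C / 4 ^+ n)))//.
  by rewrite lerD2l ler_wpM2l// exprn_ge0.
rewrite (_ : (4 : R) = 2 * 2); last by ring.
rewrite exprMn natrX exprS le_eqVlt; apply/orP; left; apply/eqP; field.
by rewrite expf_neq0.
Qed.

Let series_integrable :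
  mu.-integrable D (fun x => \sum_(0 <= n <oo) `|df n x|%:E)%E.
Proof.
have mabs n : measurable_fun D (fun x => `|df n x|%:E).
  by apply/measurable_EFinP; exact: measurableT_comp (mdf n).
apply/integrableP; split.
  by apply: ge0_emeasurable_sum => // *; rewrite lee_fin.
rewrite (eq_integral (fun x => \sum_(0 <= n <oo) `|df n x|%:E)%E); last first.
  by move=> x _; rewrite gee0_abs// nneseries_ge0// => *; rewrite lee_fin.
rewrite (integral_nneseries mu mD mabs); last by move=> *; rewrite lee_fin.
have K0 : 0 <= 2 * (fine (mu D) + C).
  rewrite mulr_ge0// addr_ge0// ?fine_ge0//.
  have := Cf (leqnn 0); rewrite expr0 divr1; apply: le_trans.
  by apply: Rintegral_ge0 => x _; exact: sqr_ge0.
apply: le_lt_trans (ltry (2 * (fine (mu D) + C))).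
apply: le_trans (epsilon_trick0 xpredT K0).
apply: lee_nneseries => n *; last exact: df_L1.
by apply: integral_ge0 => x _; rewrite lee_fin.
Qed.

Let f_cvg x : (\sum_(0 <= n <oo) `|df n x|%:E)%E \is a fin_num -> cvgn (f ^~ x).
Proof.
move=> Sfin; set S := (\sum_(0 <= n <oo) `|df n x|%:E)%E in Sfin.
have c1 : cvgn [normed series (df ^~ x)].
  apply: nondecreasing_is_cvgn.
    by apply: nondecreasing_series => n _ _; exact: normr_ge0.
  have le_S n : \sum_(0 <= k < n) `|df k x| <= fine S.
    rewrite -lee_fin fineK// -sumEFin.
    by apply: nneseries_lim_ge => *; rewrite lee_fin.
  by exists (fine S) => _ [n _ <-]; exact: le_S.
have c2 := normed_cvg c1.
rewrite (_ : f ^~ x = (fun n => f 0%N x + series (df ^~ x) n)); last first.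
  by apply/funext => n; rewrite (eq_sum_telescope (f ^~ x)).
by apply: is_cvgD => //; exact: is_cvg_cst.
Qed.

(* The series of the [`|f n.+1 - f n|] is integrable, hence finite a.e.; Fatou's
   lemma then bounds the distance to the pointwise limit. *)
Lemma square_integrable_limit : exists g, square_integrable g /\
  forall n, \int[mu]_(x in D) (f n x - g x) ^+ 2 <= C / 4 ^+ n.
Proof.
(* The upper limit is measurable and defined everywhere; it is the actual limit wherever the series
   of differences is finite, and the remaining points form a null set. *)
pose g x := fine (limn_esup (fun n => (f n x)%:E)).
have mg : measurable_fun D g.
  apply: measurableT_comp => //; apply: measurable_fun_limn_esup => n.
  by apply/measurable_EFinP; case: (Lf n).
have fg : {ae mu, forall x, D x -> f ^~ x @ \oo --> g x}.
  have := integrable_ae mD series_integrable; apply: filterS => x /[apply] /f_cvg fx.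
  have e : (fun n => (f n x)%:E) @ \oo --> (limn (f ^~ x))%:E.
    by apply: cvg_EFin; [near=> n|].
  by rewrite /g (cvg_limn_einf_sup e).2.
pose h n m x := ((f n x - f m x) ^+ 2)%:E.
have mh n m : measurable_fun D (h n m).
  by apply/measurable_EFinP; apply: measurable_funX; apply: measurable_funB; [case: (Lf n)|case: (Lf m)].
have key n : (\int[mu]_(x in D) ((f n x - g x) ^+ 2)%:E <= (C / 4 ^+ n)%:E)%E.
  have -> : (\int[mu]_(x in D) ((f n x - g x) ^+ 2)%:E =
      \int[mu]_(x in D) limn_einf (h n ^~ x))%E.
    apply: ae_eq_integral => //.
    - apply/measurable_EFinP; apply: measurable_funX; apply: measurable_funB => //.
      by case: (Lf n).
    - have -> : (fun x => limn_einf (h n ^~ x)) =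
          (fun x => - limn_esup (fun m => - h n m x))%E.
        apply/funext => x; rewrite -limn_einfN.
        by congr limn_einf; apply/funext => m; rewrite [RHS]oppeK.
      apply: measurableT_comp => //; apply: measurable_fun_limn_esup => m.
      exact: measurableT_comp (mh n m).
    - apply: filterS fg => x fgx Dx; have {}fgx := fgx Dx.
      have e : h n ^~ x @ \oo --> ((f n x - g x) ^+ 2)%:E.
        apply: cvg_EFin; first by near=> m.
        have c1 : f n x - f m x @[m --> \oo] --> f n x - g x.
          by apply: cvgB => //; exact: cvg_cst.
        by rewrite expr2; exact: (cvgM c1 c1).
      by rewrite (cvg_limn_einf_sup e).1.
  apply: le_trans (fatou mu mD (mh n) _) _.
    by move=> m x _; rewrite lee_fin sqr_ge0.
  apply: (@limn_einf_le _ n) => m nm.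
  have [_ I] := square_integrableB (Lf n) (Lf m).
  by rewrite integral_EFin// lee_fin Cf.
have Lfg n : square_integrable (fun x => f n x - g x).
  have m1 : measurable_fun D (fun x => f n x - g x).
    by apply: measurable_funB => //; case: (Lf n).
  split => //; apply/integrableP; split.
    by apply/measurable_EFinP; exact: measurable_funX.
  rewrite (eq_integral (fun x => ((f n x - g x) ^+ 2)%:E)); last first.
    by move=> x _; rewrite gee0_abs// lee_fin sqr_ge0.
  by rewrite (le_lt_trans (key n))// ltry.
exists g; split.
  have := square_integrableB (Lf 0%N) (Lfg 0%N).
  by congr square_integrable; apply/funext => x; rewrite opprB addrCA subrr addr0.
by move=> n; have [_ I] := Lfg n; rewrite -lee_fin -(integral_EFin I) key.
Unshelve. all: by end_near. Qed.

End rapid.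
End L2_limit.

Section completeness.
Context (R : realType) (Omega : open_set R).
Hypothesis Omega_bounded : bounded_set Omega.

Let mOmega : measurable (Omega : set (mplane R)).
Proof. by apply: open_measurable2; exact: oset_open. Qed.

Local Notation H := (H1_semi_inner Omega).

(** Young's inequality with a free weight: [t = 2 ^+ n] will balance a squared error of order
    [4 ^- n] against a fixed test function. *)
Lemma L2_integral_mul_le (f h : R * R -> R) t : L2 Omega f -> L2 Omega h -> 0 < t ->
  `|\int[lebesgue2]_(x in Omega) (f x * h x)| <=
  t * \int[lebesgue2]_(x in Omega) (f x ^+ 2) +
  t^-1 * \int[lebesgue2]_(x in Omega) (h x ^+ 2).
Proof.
move=> Lf Lh t0; have [_ If] := Lf; have [_ Ih] := Lh.
have I := L2_mul_integrable Lf Lh.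
rewrite (le_trans (le_normr_Rintegral mOmega I))// -!RintegralZl// -RintegralD//; try exact: integrable_funZ.
apply: le_Rintegral => //; first exact: (integrable_abse I).
  by apply: integrable_funD => //; exact: integrable_funZ.
move=> x _; rewrite normrM -(real_normK (num_real (f x))) -(real_normK (num_real (h x))).
rewrite -(ler_pM2l t0) mulrDr mulrA [t * (t^-1 * _)]mulrA mulfV ?gt_eqF// mul1r.
have := sqr_ge0 (t * `|f x| - `|h x|).
have : 0 <= t * (`|f x| * `|h x|) by rewrite !mulr_ge0// ltW.
rewrite sqrrB; have := sqr_ge0 (t * `|f x|); have := sqr_ge0 `|h x|.
rewrite exprMn expr2; nra.
Qed.

Lemma sipnorm_rapid (u : nat -> H1_fun Omega) :
  (forall n, sipnorm H (u n.+1 - u n) <= 2 ^- n) ->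
  forall n m, (n <= m)%N -> sipnorm H (u n - u m) <= 2 * 2 ^- n.
Proof.
move=> hu n m nm; rewrite -(subnKC nm); move: (m - n)%N => j {m nm}.
(* The induction needs the geometric tail [2 * 2 ^- (n + j)] subtracted; it is dropped at the
   end. *)
have : sipnorm H (u n - u (n + j)%N) <= 2 * 2 ^- n - 2 * 2 ^- (n + j).
  elim: j => [|j IHj].
    by rewrite addn0 !subrr -(scale0r 0) sipnormZ normr0 mul0r.
  have := sipnormD H (u n - u (n + j)%N) (u (n + j)%N - u (n + j.+1)%N).
  rewrite addrA subrK => /le_trans; apply.
  have : sipnorm H (u (n + j)%N - u (n + j.+1)%N) <= 2 ^- (n + j).
    by rewrite -opprB -scaleN1r sipnormZ normrN1 mul1r addnS.
  have -> : (2 ^- (n + j.+1) : R) = 2^-1 * 2 ^- (n + j).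
    by rewrite addnS exprS invfM.
  move: IHj; move: (sipnorm H (u n - u (n + j)%N)) => a.
  move: (sipnorm H (u (n + j)%N - u (n + j.+1)%N)) (2 ^- n) (2 ^- (n + j)) => b c e.
  lra.
move/le_trans; apply; rewrite gerBl mulr_ge0// invr_ge0 exprn_ge0//.
Qed.

Lemma H1_innerE (u : H1_fun Omega) : H u u =
  \int[lebesgue2]_(x in Omega) (fn u x ^+ 2) +
  \sum_i \int[lebesgue2]_(x in Omega) (grad u i x ^+ 2).
Proof.
have [u0 u1 _] := H1_fun_is_H1 u.
have I2 i : lebesgue2.-integrable Omega (EFin \o (fun x => grad u i x ^+ 2)).
  by case: (u1 i).
rewrite -[H u u]/(H1_inner u u) /H1_inner.
rewrite RintegralD//; [|exact: L2_mul_integrable|exact: grad_dot_integrable].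
congr (_ + _); rewrite !big_ord_recl big_ord0 addr0.
rewrite -RintegralD//.
by apply: eq_Rintegral => x _; rewrite !big_ord_recl big_ord0 addr0.
Qed.

(** Limits are taken separately for the function and for each gradient component; the weak
    derivative identity survives because it is tested against fixed [L2] functions. The constant is
    [12 = 3 * 4]: three components, each within [(2 * 2 ^- n) ^+ 2]. *)
Lemma H1_fun_complete (u : nat -> H1_fun Omega) :
  (forall n, sipnorm H (u n.+1 - u n) <= 2 ^- n) ->
  exists w, forall n, sipnorm H (u n - w) ^+ 2 <= 12 / 4 ^+ n.
Proof.
move=> /sipnorm_rapid hu.
have muO : (lebesgue2 (Omega : set (mplane R)) < +oo)%E by exact: bounded_lebesgue2_lty.
have hu2 n m : (n <= m)%N -> H (u n - u m) (u n - u m) <= 4 / 4 ^+ n.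
  move=> nm; rewrite -sipnorm_sqr (_ : 4 / 4 ^+ n = (2 * 2 ^- n) ^+ 2).
    by rewrite ler_pXn2r ?nnegrE ?sqrtr_ge0 ?mulr_ge0 ?invr_ge0 ?exprn_ge0// hu.
  rewrite exprMn exprVn -exprM mulnC exprM (_ : (2 : R) ^+ 2 = 4)//.
  by ring.
have sq_ge0 (f : R * R -> R) : 0 <= \int[lebesgue2]_(x in Omega) (f x ^+ 2).
  by apply: Rintegral_ge0 => x _; exact: sqr_ge0.
have hf n m : (n <= m)%N ->
    \int[lebesgue2]_(x in Omega) (fn (u n) x - fn (u m) x) ^+ 2 <= 4 / 4 ^+ n.
  move=> /hu2; rewrite H1_innerE; apply: le_trans; rewrite lerDl.
  by apply: sumr_ge0.
have hg i n m : (n <= m)%N ->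
    \int[lebesgue2]_(x in Omega) (grad (u n) i x - grad (u m) i x) ^+ 2 <= 4 / 4 ^+ n.
  move=> /hu2; rewrite H1_innerE; apply: le_trans.
  by rewrite ler_wpDl// (bigD1 i)//= lerDl sumr_ge0.
have L n := H1_fun_is_H1 (u n).
have [|f [Lf Hf]] := square_integrable_limit mOmega muO _ hf.
  by move=> n; case: (L n).
have /choice[g Hg] i : exists g, L2 Omega g /\ forall n,
    \int[lebesgue2]_(x in Omega) (grad (u n) i x - g x) ^+ 2 <= 4 / 4 ^+ n.
  have [|g [Lg Hg]] := square_integrable_limit mOmega muO _ (hg i); last by exists g.
  by move=> n; case: (L n) => _ h _; exact: h.
have Ew : is_H1 Omega (f, g).
  split; [exact: Lf|by move=> i; case: (Hg i)|move=> i phi tphi].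
  have Lp := test_function_L2 tphi; have Ldp := partial_test_function_L2 i tphi.
  have [Lgi Hgi] := Hg i.
  set A := \int[lebesgue2]_(x in Omega) (f x * partial i phi x).
  set B := \int[lebesgue2]_(x in Omega) (g i x * phi x).
  set P := \int[lebesgue2]_(x in Omega) (phi x ^+ 2).
  set Q := \int[lebesgue2]_(x in Omega) (partial i phi x ^+ 2).
  (* The identity holds exactly for [u n], so [A + B] consists of two error integrals. With weight
     [2 ^+ n], each is at most [4 * 2 ^- n] plus [2 ^- n] times [P] or [Q]. *)
  have key n : `|A + B| <= (8 + P + Q) * 2 ^- n.
    have [u0 u1 uw] := L n.
    have d1 := square_integrableB mOmega u0 Lf.
    have d2 := square_integrableB mOmega (u1 i) Lgi.
    have t0 : 0 < 2 ^+ n :> R by rewrite exprn_gt0.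
    have pw : 2 ^+ n * (4 / 4 ^+ n) = 4 * 2 ^- n :> R.
      have -> : (4 : R) ^+ n = 2 ^+ n * 2 ^+ n by rewrite -exprMn -natrM.
      by field; rewrite gt_eqF.
    have e1 : A = \int[lebesgue2]_(x in Omega) (fn (u n) x * partial i phi x) -
        \int[lebesgue2]_(x in Omega) ((fn (u n) x - f x) * partial i phi x).
      rewrite -RintegralB//; try exact: L2_mul_integrable.
      by apply: eq_Rintegral => x _; ring.
    have e2 : B = \int[lebesgue2]_(x in Omega) (grad (u n) i x * phi x) -
        \int[lebesgue2]_(x in Omega) ((grad (u n) i x - g i x) * phi x).
      rewrite -RintegralB//; try exact: L2_mul_integrable.
      by apply: eq_Rintegral => x _; ring.
    have := L2_integral_mul_le d1 Ldp t0; have := L2_integral_mul_le d2 Lp t0.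
    have h1 : 2 ^+ n * \int[lebesgue2]_(x in Omega) (fn (u n) x - f x) ^+ 2 <= 4 * 2 ^- n.
      by rewrite (le_trans (ler_wpM2l (ltW t0) (Hf n)))// pw.
    have h2 : 2 ^+ n * \int[lebesgue2]_(x in Omega) (grad (u n) i x - g i x) ^+ 2 <= 4 * 2 ^- n.
      by rewrite (le_trans (ler_wpM2l (ltW t0) (Hgi n)))// pw.
    rewrite -/P -/Q => k2 k1.
    rewrite (uw i phi tphi) in e1.
    move: e1 e2 k1 k2 h1 h2 => -> ->.
    move: (\int[lebesgue2]_(x in Omega) (grad (u n) i x * phi x)) => a.
    move: (\int[lebesgue2]_(x in Omega) ((fn (u n) x - f x) * partial i phi x)) => b.
    move: (\int[lebesgue2]_(x in Omega) ((grad (u n) i x - g i x) * phi x)) => c.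
    move: (\int[lebesgue2]_(x in Omega) (fn (u n) x - f x) ^+ 2) => b2.
    move: (\int[lebesgue2]_(x in Omega) (grad (u n) i x - g i x) ^+ 2) => c2.
    move=> /ler_normlP[k1 k2] /ler_normlP[k3 k4] h1 h2.
    have -> : - a - b + (a - c) = - (b + c) by ring.
    rewrite normrN; apply/ler_normlP.
    have E4 : (8 + P + Q) * 2 ^- n = 8 * 2 ^- n + 2 ^- n * Q + 2 ^- n * P by ring.
    move: E4 k1 k2 k3 k4 h1 h2.
    move: ((8 + P + Q) * 2 ^- n) (2 ^- n * P) (2 ^- n * Q) (2 ^+ n * b2) (2 ^+ n * c2) (2 ^- n) => e1 e2 e3 e4 e5 e6.
    by move=> *; split; lra.
  apply/eqP; rewrite -addr_eq0 -normr_le0.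
  have c : (8 + P + Q) * 2 ^- n @[n --> \oo] --> (0 : R).
    rewrite -(mulr0 (8 + P + Q)); apply: cvgMl_tmp; under eq_fun do rewrite -exprVn.
    by apply: cvg_expr; rewrite ger0_norm ?invr_ge0// invf_lt1// ltr1n.
  by apply: (ler_cvg_to (@cvg_cst _ `|A + B| _ \oo _) c); near=> n; exact: key.
have Ew' : (f, g) \in in_H1 Omega by rewrite inE.
exists (MkH1_fun Ew') => n; rewrite sipnorm_sqr H1_innerE.
rewrite !big_ord_recl big_ord0 addr0.
have := Hf n; have := (Hg ord0).2 n; have := (Hg (lift ord0 ord0)).2 n.
lra.
Unshelve. all: by end_near. Qed.

Lemma H10_rapidly_complete : rapidly_complete (H10 Omega).
Proof.
move=> u hu; pose v n : H1_fun Omega := repr (H10_val (u n)).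
have vq n : H1_class (v n) = H10_val (u n) by exact: H1_classK.
have [|w Hw] := @H1_fun_complete v.
  move=> n; rewrite -H1_pi_norm H1_classB !vq.
  exact: hu.
have c : H10_val (u n) @[n --> \oo] --> H1_class w.
  apply/cvgrPdist_le => e e0.
  have c : 12 / 4 ^+ n @[n --> \oo] --> (0 : R).
    rewrite -(mulr0 12); apply: cvgMl_tmp; under eq_fun do rewrite -exprVn.
    by apply: cvg_expr; rewrite ger0_norm ?invr_ge0// invf_lt1// ltr1n.
  have e2 : 0 < e ^+ 2 by rewrite exprn_gt0.
  move/cvgrPdist_le : c => /(_ _ e2); apply: filterS => n.
  rewrite sub0r normrN ger0_norm ?divr_ge0 ?exprn_ge0// => h.
  rewrite distrC -vq -H1_classB H1_pi_norm.
  by rewrite -(@ler_pXn2r _ 2) ?nnegrE ?sqrtr_ge0 ?(ltW e0)// (le_trans (Hw n)).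
have qw : H1_class w \in @in_H10 R Omega.
  rewrite inE; apply: (@closed_cvg _ _ _ _ (fun n => H10_val (u n)) (closure (@H1_test R Omega)) _ _ _ c).
    exact: closed_closure.
  by near=> n; have := valP (u n); rewrite inE.
exists (MkH10 qw); apply/cvgrPdist_le => e e0.
by move/cvgrPdist_le : c => /(_ _ e0).
Unshelve. all: by end_near. Qed.

End completeness.

(** * Weights and approximate eigenfunctions *)

Section weights.
Context (R : realType) (Omega : open_set R).
Hypothesis Omega_bounded : bounded_set Omega.
Local Notation H := (H1_semi_inner Omega).

Let mOmega : measurable (Omega : set (mplane R)).
Proof. by apply: open_measurable2; exact: oset_open. Qed.

Lemma bounded_coord : exists2 N : R, 0 <= N &
  forall x, closure Omega x -> `|x| <= N.
Proof.
have [M [_ HM]] := Omega_bounded.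
exists (`|M| + 1) => [|x cx]; first by rewrite addr_ge0.
have M1 : M < `|M| + 1 by rewrite (le_lt_trans (ler_norm M))// ltrDl.
apply/ler_addgt0Pr => e e0.
have [y [Oy xy]] := cx _ (nbhsx_ballx x e e0).
rewrite -[x](subrK y) (le_trans (ler_normD _ _))// addrC lerD//.
  exact: HM M1 _ Oy.
by move: xy; rewrite -ball_normE /= => /ltW.
Qed.

Lemma closure_bounded_compact : compact (closure (Omega : set (R * R))).
Proof.
have [N N0 HN] := bounded_coord.
apply: (@subclosed_compact _ (closure Omega) (`[- N, N]%classic `*` `[- N, N]%classic)).
- exact: closed_closure.
- by apply: compact_setX; exact: segment_compact.
- move=> x /HN; rewrite prod_normE ge_max => /andP[h1 h2].
  by split; rewrite /= in_itv/= -ler_norml.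
Qed.

Lemma continuous_bounded_weight k : {within closure Omega, continuous k} ->
  exists2 M, bounded_weight Omega k M & forall x, closure Omega x -> `|k x| <= M.
Proof.
move=> ck.
have /compact_bounded[M [_ HM]] := continuous_compact ck closure_bounded_compact.
have M1 : M < `|M| + 1 by rewrite (le_lt_trans (ler_norm M))// ltrDl.
have kM x : closure Omega x -> `|k x| <= `|M| + 1.
  by move=> cx; apply: (HM _ M1); exists x.
exists (`|M| + 1) => //; split; first by rewrite addr_ge0.
- have : {within (Omega : set (R * R)), continuous k}.
    by apply: continuous_subspaceW ck; exact: subset_closure.
  rewrite continuous_open_subspace; last exact: oset_open.
  move=> kO; apply: (measurability _ (measurable_realfun.RGenOpens.measurableE R)).
  move=> _ [_ [a [b ->] <-]]; apply: open_measurable2.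
  rewrite openE => x [Ox kx]; apply: filterI.
    by apply: open_nbhs_nbhs; split => //; exact: oset_open.
  apply: kO; first by rewrite inE.
  by apply: open_nbhs_nbhs; split => //; exact: itv_open.
- by move=> x Ox; apply: kM; exact: subset_closure.
Qed.

Lemma bounded_weight_lin (s l Mg Mk : R) g k : bounded_weight Omega g Mg ->
  bounded_weight Omega k Mk ->
  bounded_weight Omega (fun z => s * (l * g z - k z)) (`|s| * (`|l| * Mg + Mk)).
Proof.
move=> [Mg0 mg gM] [Mk0 mk kM]; split; first by rewrite mulr_ge0// addr_ge0// mulr_ge0.
  by apply: measurable_funM => //; apply: measurable_funB => //; apply: measurable_funM.
move=> x Ox; rewrite normrM ler_wpM2l// (le_trans (ler_normB _ _))// normrM.
by rewrite lerD ?ler_wpM2l ?gM ?kM.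
Qed.

Lemma gradient_form_lin (s l Mg Mk : R) g k (u v : H1_fun Omega) :
  bounded_weight Omega g Mg -> bounded_weight Omega k Mk ->
  gradient_form (fun z => s * (l * g z - k z)) u v =
  s * (l * gradient_form g u v - gradient_form k u v).
Proof.
move=> Hg Hk; have Ig := gradient_form_integrable u v Hg.
have Ik := gradient_form_integrable u v Hk.
rewrite /gradient_form -RintegralZl// -RintegralB//; last exact: integrable_funZ.
rewrite -RintegralZl//; last first.
  have := integrable_funD mOmega (integrable_funZ l mOmega Ig) (integrable_funZ (-1) mOmega Ik).
  by apply: eq_integrable => // x _ /=; rewrite mulN1r.
by apply: eq_Rintegral => x _; ring.
Qed.

(** Otherwise the bump would vanish almost everywhere on [Omega], and the open box where it is
    positive, of area [(b - a) * (d - c)], would lie in a null set. *)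
Lemma sipnorm_bump_neq0 (a b c d : R) (w : H1_fun Omega) : a < b -> c < d ->
  `[a, b]%classic `*` `[c, d]%classic `<=` Omega ->
  fn w = bump a b c d -> sipnorm H w != 0.
Proof.
move=> ab cd sub wE; apply/negP => /eqP w0.
have [[mw Iw] L1 _] := H1_fun_is_H1 w.
have I0 : \int[lebesgue2]_(x in Omega) (fn w x ^+ 2) = 0.
  have : H w w = 0 by rewrite -sipnorm_sqr w0 expr0n.
  rewrite H1_innerE => /eqP.
  have p0 (f : R * R -> R) : 0 <= \int[lebesgue2]_(x in Omega) (f x ^+ 2).
    by apply: Rintegral_ge0 => x _; exact: sqr_ge0.
  by rewrite paddr_eq0 ?sumr_ge0// => /andP[/eqP].
have I1 : (\int[lebesgue2]_(x in Omega) `|(fn w x ^+ 2)%:E| = 0)%E.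
  rewrite (eq_integral (fun x : mplane R => (fn w x ^+ 2)%:E)); last first.
    by move=> x _; rewrite gee0_abs// lee_fin sqr_ge0.
  by rewrite integral_EFin// I0.
have mw2 : measurable_fun (Omega : set (mplane R)) (fun x => (fn w x ^+ 2)%:E).
  by apply/measurable_EFinP; exact: measurable_funX.
have [N [mN N0 subN]] := (ae_eq_integral_abs lebesgue2 mOmega mw2).1 I1.
pose J : set (mplane R) := `]a, b[%classic `*` `]c, d[%classic.
have mJ : measurable J by apply: measurableX; exact: measurable_itv.
have JN : J `<=` N.
  move=> x [/=]; rewrite !in_itv/= => xab xcd; apply: subN => /= h.
  have Ox : oset Omega x.
    apply: sub; move: xab xcd => /andP[h1 h2] /andP[h3 h4].
    by split; rewrite /= in_itv/= !ltW.
  have /eqP := h Ox; rewrite eqe sqrf_eq0 wE gt_eqF//.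
  by rewrite bump_gt0 xab xcd.
have : (lebesgue2 J <= lebesgue2 N)%E by apply: le_measure => //; rewrite inE.
rewrite N0 leNgt => /negP; apply.
have E (p q : R) : p < q -> @lebesgue_measure R `]p, q[%classic = (q - p)%:E.
  by move=> pq; rewrite lebesgue_measure_itv/= lte_fin pq EFinB.
have -> : (lebesgue2 J = ((b - a) * (d - c))%:E)%E.
  rewrite /J product_measure1E; try exact: measurable_itv.
  by rewrite EFinM; congr (_ * _)%E; exact: E.
by rewrite lte_fin mulr_gt0// subr_gt0.
Qed.

Lemma approximate_eigenfunction h M z0 e : {within closure Omega, continuous h} ->
  bounded_weight Omega h M -> closure Omega z0 -> `|h z0| < e ->
  exists u : H10 Omega, u != 0 /\
    forall v, `|weighted_laplacian h u v| <= e * (`|u| * `|v|).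
Proof.
move=> /subspace_continuousP ch [M0 mh hM] cz0 hz0.
have e0 : 0 < e by rewrite (le_lt_trans _ hz0).
have near_h : nbhs z0 [set z | closure Omega z -> `|h z| < e].
  have op : nbhs (h z0) [set t | `|t| < e].
    apply: open_nbhs_nbhs; split => //.
    have -> : [set t : R | `|t| < e] = ball (0 : R) e.
      by apply/seteqP; split => t; rewrite -ball_normE /= sub0r normrN.
    exact: ball_open.
  by have := ch z0 cz0 _ op.
(* [z0] may be a boundary point; the bump is centred at a point of [Omega] close to it, around which
   [h] is still small. *)
have [z1 [Oz1 z1e]] := cz0 _ (nbhs_interior near_h).
have : nbhs z1 (oset Omega `&` [set z | closure Omega z -> `|h z| < e]).
  apply: filterI => //; apply: open_nbhs_nbhs; split => //; exact: oset_open.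
case/nbhs_ballP => r /= r0 rsub.
pose a := z1.1 - r / 2; pose b := z1.1 + r / 2.
pose c := z1.2 - r / 2; pose d := z1.2 + r / 2.
pose J : set (mplane R) := `[a, b]%classic `*` `[c, d]%classic.
have Jball : J `<=` ball z1 r.
  move=> z [/=]; rewrite /a /b /c /d !in_itv/= => /andP[h1 h2] /andP[h3 h4].
  by split; rewrite /ball/= ltr_norml; apply/andP; split; move: h1 h2 h3 h4 r0; lra.
have JO : J `<=` Omega by move=> z /Jball /rsub[].
have Jh z : J z -> `|h z| < e.
  by move=> /Jball /rsub[Oz]; apply; exact: subset_closure.
have ab : a < b by rewrite /a /b; move: r0; lra.
have cd : c < d by rewrite /c /d; move: r0; lra.
have tb := bump_test_function JO.
have Hw := test_function_is_H1 tb.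
have Hw' : (bump a b c d, fun i => partial i (bump a b c d)) \in in_H1 Omega.
  by rewrite inE.
pose w : H1_fun Omega := MkH1_fun Hw'.
have qw : H1_class w \in @in_H10 R Omega.
  by rewrite inE; apply: subset_closure; exists w.
exists (MkH10 qw); split.
  rewrite -normr_eq0 -[`|_|]/`|H1_class w| H1_pi_norm.
  exact: (sipnorm_bump_neq0 ab cd JO).
move=> v; have hb : bounded_weight Omega h M by [].
rewrite weighted_laplacianE (gradient_form_class _ _ hb).
have mJ : measurable J by apply: measurableX; exact: measurable_itv.
(* The gradient of the bump vanishes off [J], so cutting [h] off outside [J] leaves the form
   unchanged while lowering the bound on the weight to [e]. *)
pose h' z := h z * \1_J z.
have h'b : bounded_weight Omega h' e.
  split; [exact: ltW| |].
    apply: measurable_funM => //; exact: measurable_indic.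
  move=> x Ox; rewrite /h' indicE; case: (boolP (x \in J)) => [|_].
    by rewrite inE mulr1 => /Jh /ltW.
  by rewrite mulr0 normr0 ltW.
have -> : gradient_form h w (repr (H10_val v)) = gradient_form h' w (repr (H10_val v)).
  apply: eq_Rintegral => x _; rewrite /h' indicE; case: (boolP (x \in J)) => [|xJ].
    by rewrite mulr1.
  rewrite mulr0 mul0r big1 ?mulr0// => i _.
  rewrite [grad w i x]partial_support ?mul0r// => /bump_support Jx.
  by move/negP: xJ; apply; rewrite inE.
rewrite (le_trans (gradient_form_bound _ _ h'b))// ler_wpM2l ?(ltW e0)//.
by rewrite -[`|MkH10 qw|]/`|H1_class w| H1_pi_norm.
Qed.

End weights.

(** * Density of a bounded interval between its bounds *)

Section intervals.
Context (R : realType).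

(** Points of [I] close to [inf I] and to [sup I] either enclose [x] or one of them is within [e] of
    it. Approximation covers the endpoints of the spectrum without showing that they are
    attained. *)
Lemma interval_approx (I : set R) x e : is_interval I -> I !=set0 ->
  has_lbound I -> has_ubound I -> inf I <= x <= sup I -> 0 < e ->
  exists2 y, I y & `|x - y| < e.
Proof.
move=> iI I0 lI uI /andP[xi xs] e0.
have [p Ip pe] := inf_adherent e0 (conj I0 lI).
have [q Iq qe] := sup_adherent e0 (conj I0 uI).
have [px|xp] := leP p x; last first.
  by exists p => //; rewrite ltr_norml; apply/andP; split; lra.
have [xq|qx] := leP x q.
  by exists x; [apply: (iI p q) => //; rewrite px|rewrite subrr normr0].
by exists q => //; rewrite ltr_norml; apply/andP; split; lra.
Qed.

End intervals.

(** * The spectrum as the range of the quotient of the coefficients *)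

Unset Implicit Arguments.

Theorem theorem3p1 (R : realType) (Omega : open_set R)
    (Omega_neq0 : (Omega : set (R * R)) !=set0)
    (Omega_connected : connected Omega)
    (Omega_bounded : bounded_set Omega)
    (Omega_lipschitz : lipschitz_boundary Omega)
    (g k : R * R -> R)
    (g_pos : uniformly_positive (closure Omega) g)
    (k_pos : uniformly_positive (closure Omega) k)
    (g_cont : {within closure Omega, continuous g})
    (k_cont : {within closure Omega, continuous k}) :
  let A : H10 Omega -> H10 Omega -> R := weighted_laplacian k in
  let B : H10 Omega -> H10 Omega -> R := weighted_laplacian g in
  let Binv := 'pinv_(fun=> 0) setT B in
  let ratio := [set k x / g x | x in closure Omega] in
  [/\ set_fun setT (dual (H10 Omega)) A,
      set_bij setT (dual (H10 Omega)) B &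
      spectrum (Binv \o A) = [set x%:C%C | x in `[inf ratio, sup ratio]]].
Proof.
move=> A B Binv ratio.
have Oc : (Omega : set (R * R)) `<=` closure Omega by exact: subset_closure.
have CV := H10_rapidly_complete Omega_bounded.
have [N N0 HN] := bounded_coord Omega_bounded.
have HN1 x : oset Omega x -> `|x.1| <= N.
  by move=> /Oc /HN; rewrite prod_normE ge_max => /andP[].
have [Mg wg gM] := continuous_bounded_weight Omega_bounded g_cont.
have [Mk wk _] := continuous_bounded_weight Omega_bounded k_cont.
have [cg cg0 Hg] := g_pos; have [ck ck0 Hk] := k_pos.
have FA : bounded_form A Mk := weighted_laplacian_form wk.
have FB : bounded_form B Mg := weighted_laplacian_form wg.
have CB := weighted_laplacian_coercive cg0 wg (fun x Ox => Hg x (Oc x Ox)) N0 HN1.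
have Bbij : set_bij setT (dual (H10 Omega)) B.
  split=> [u _|u v _ _ uv|F dF].
  - exact: bform_dual FB u.
  - by apply: (form_eq FB CB) => w; rewrite -/B uv.
  - have [u Hu] := riesz CV FB CB dF.
    by exists u => //; apply/funext.
split=> [u _||]; first exact: bform_dual FA u.
  exact: Bbij.
(* [A u] lies in the dual, onto which [B] is surjective, so [B] undoes the pseudo-inverse there. *)
have bT u v : B ((Binv \o A) u) v = A u v.
  congr (_ v); apply: (@surjpK _ _ _ _ (dual (H10 Omega))).
    by case: Bbij.
  by rewrite inE; exact: bform_dual FA u.
have lin l s u v : s * (l * B u v - A u v) =
    weighted_laplacian (fun z => s * (l * g z - k z)) u v.
  by rewrite weighted_laplacianE (gradient_form_lin _ _ _ _ wg wk).
have ratio_cont : {within closure Omega, continuous (fun x => k x / g x)}.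
  apply/subspace_continuousP => x cx; apply: cvgM.
    by move/subspace_continuousP: k_cont; exact.
  apply: cvgV; first by rewrite gt_eqF// (lt_le_trans cg0)// Hg.
  by move/subspace_continuousP: g_cont; exact.
have [x0 Ox0] := Omega_neq0.
have ratio0 : ratio !=set0 by exists (k x0 / g x0), x0 => //; exact: Oc.
have ratio_bd : bounded_set ratio.
  exact: compact_bounded (continuous_compact ratio_cont (closure_bounded_compact Omega_bounded)).
have ratio_int : is_interval ratio.
  apply/connected_intervalP; apply: connected_continuous_connected ratio_cont.
  exact: connected_closure.
have [Mr [_ HMr]] := ratio_bd.
have Mr1 : Mr < Mr + 1 by rewrite ltrDl.
have lr : has_lbound ratio.
  by exists (- (Mr + 1)) => y /(HMr _ Mr1) /=; rewrite ler_norml => /andP[].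
have ur : has_ubound ratio.
  by exists (Mr + 1) => y /(HMr _ Mr1) /=; rewrite ler_norml => /andP[_].
have real_case x : has_bounded_inverse (fun u : H10 Omega => x *: u - (Binv \o A) u) <->
    ~ (inf ratio <= x <= sup ratio).
  split=> [inv xr|xr].
    apply: (approximate_eigenvalue FB CB bT _ inv) => e e0.
    have Mg0 : 0 <= Mg by case: wg.
    (* Since [x g - k = g (x - k / g)] and [|g| <= Mg], this closeness of [x] to a value of [k / g]
       makes the weight smaller than [e]. *)
    have d0 : 0 < e / (Mg + 1) by rewrite divr_gt0// ltr_wpDl.
    have [_ [z cz <-] xz] := interval_approx ratio_int ratio0 lr ur xr d0.
    have h_cont : {within closure Omega, continuous (fun z => 1 * (x * g z - k z))}.
      apply/subspace_continuousP => y cy; apply: cvgMl_tmp; apply: cvgB.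
        by apply: cvgMl_tmp; move/subspace_continuousP: g_cont; exact.
      by move/subspace_continuousP: k_cont; exact.
    have hz : `|1 * (x * g z - k z)| < e.
      have g0 : 0 < g z by rewrite (lt_le_trans cg0)// Hg.
      have -> : 1 * (x * g z - k z) = g z * (x - k z / g z).
        by field; rewrite gt_eqF.
      rewrite normrM (@le_lt_trans _ _ (Mg * `|x - k z / g z|))//.
        by rewrite ler_wpM2r// gM.
      rewrite (@le_lt_trans _ _ (Mg * (e / (Mg + 1))))//.
        by rewrite ler_wpM2l// ltW.
      by rewrite mulrCA gtr_pMr// ltr_pdivrMr ?mul1r ?ltrDl// ltr_wpDl.
    have wh := bounded_weight_lin 1 x wg wk.
    have [u [u0 Hu]] := approximate_eigenfunction h_cont wh cz hz.
    by exists u; split => // v; have := Hu v; rewrite -lin mul1r.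
  have coer s c : 0 < c -> (forall z, oset Omega z -> c <= s * (x * g z - k z)) ->
      coercive (fun u v => s * (x * B u v - A u v)) (c / (2 * N + 1) ^+ 2).
    move=> c0 Hc.
    have := weighted_laplacian_coercive c0 (bounded_weight_lin s x wg wk) Hc N0 HN1.
    by congr coercive; apply/funext => u; apply/funext => v; rewrite lin.
  (* Below the range, [- (x g - k) = g (k / g - x)] is at least [cg * (inf ratio - x)]; above it,
     [x g - k] is bounded below in the same way by [cg * (x - sup ratio)]. *)
  have [xi|xi] := ltP x (inf ratio).
    apply: (real_resolvent CV FB CB FA bT (s := -1)); last first.
      apply: (coer _ (cg * (inf ratio - x))); first by rewrite mulr_gt0// subr_gt0.
      move=> z /Oc cz; have gz := Hg z cz; have g0 := lt_le_trans cg0 gz.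
      have -> : -1 * (x * g z - k z) = g z * (k z / g z - x).
        by field; rewrite gt_eqF.
      have xz : inf ratio <= k z / g z by apply: ge_inf => //; exists z.
      by rewrite ler_pM ?(ltW cg0) ?subr_ge0 ?(ltW xi)// lerD2r.
    by rewrite oppr_eq0 oner_eq0.
  have xs : sup ratio < x by rewrite ltNge; apply/negP => h; apply: xr; rewrite xi.
  apply: (real_resolvent CV FB CB FA bT (s := 1)); last first.
    apply: (coer _ (cg * (x - sup ratio))); first by rewrite mulr_gt0// subr_gt0.
    move=> z /Oc cz; have gz := Hg z cz; have g0 := lt_le_trans cg0 gz.
    have -> : 1 * (x * g z - k z) = g z * (x - k z / g z).
      by field; rewrite gt_eqF.
    have xz : k z / g z <= sup ratio by apply: ub_le_sup => //; exists z.
    by rewrite ler_pM ?(ltW cg0) ?subr_ge0 ?(ltW xs)// lerD2l lerN2.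
  exact: oner_neq0.
apply/seteqP; split => [[x y]|_ [x xr <-]].
  rewrite /spectrum /resolvent_set /=; case: eqVneq => [->|y0].
    rewrite real_case => /contrapT xr; by exists x => //=; rewrite ?in_itv.
  by case; exact: (nonreal_resolvent CV FB CB FA bT).
rewrite /spectrum /resolvent_set /= eqxx real_case.
by move: xr; rewrite /= in_itv /= => xr; apply.
Qed.
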